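(* Let $F$ be a finite set of polynomials in the variables $x_1,\dots,x_n$, each of which is either a monomial or a binomial $u-v$ with $u,v$ monomials of the same degree. For every field $K$ let $S_K=K[x_1,\dots,x_n]$, let $I_K\subset S_K$ be the ideal generated by $F$, and let $R_K=S_K/I_K$. Suppose that for some field $K$ the ring $R_K$ admits a special system of parameters. Then the Cohen--Macaulay property of $R_K$ does not depend on the base field, i.e. for every field $K'$, the ring $R_{K'}$ is Cohen--Macaulay if and only if $R_K$ is Cohen--Macaulay.
   Context: An ideal of a polynomial ring is called a binomial ideal if it is generated by monomials and binomials of the form $u-v$ with $u,v$ monomials (all generators may be monomials, or all may be binomials). The polynomial ring has the standard grading $\deg x_i=1$. A special system of parameters of a standard graded $K$-algebra $R=S/I$ of dimension $d$ (with respect to the variables $x_1,\dots,x_n$) is a system of parameters $s_1,\dots,s_d$ of $R$ such that each $s_j$ is the residue class either of a variable $x_i$ or of a difference $x_k-x_i$ of two variables. *)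

(* Defs.v *)
From HB Require Import structures.
From mathcomp Require Import all_boot all_order all_algebra.
From mathcomp Require Import ring_quotient.
From mathcomp Require Export mpoly.

Set Implicit Arguments.
Unset Strict Implicit.
Unset Printing Implicit Defensive.

Import GRing.Theory.
Local Open Scope ring_scope.

(* A quotient ring A/(G) is handled through the finite list G of generators of
   its ideal: A/(G) is the zero ring iff 1 is in (G), its prime ideals are the
   primes of A containing G, and the further quotient by the classes of the
   elements of a list s is A/(G ++ s). *)
Section Quotient.

Variable A : comNzRingType.
Implicit Types G s : seq A.

Definition in_ideal G (f : A) : Prop :=
  exists c : 'I_(size G) -> A, f = \sum_(i < size G) c i * G`_i.

(* Properness is part of idealr_closed. *)
Definition prime_ideal (P : {pred A}) : Prop := idealr_closed P /\ prime_idealr_closed P.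

(* P 0 < P 1 < ... < P d; the values of P above d are irrelevant. *)
Definition prime_chain G (d : nat) (P : nat -> {pred A}) : Prop :=
  (forall i, (i <= d)%N -> prime_ideal (P i) /\ {subset G <= P i}) /\
  (forall i, (i < d)%N ->
     {subset P i <= P i.+1} /\ ~ {subset P i.+1 <= P i}).

(* The Krull dimension of A/(G) is the natural number d; this fails for every
   d when A/(G) = 0. *)
Definition has_krull_dim G (d : nat) : Prop :=
  (exists P, prime_chain G d P) /\
  (forall e P, prime_chain G e P -> (e <= d)%N).

Definition regular_seq G s : Prop :=
  (forall i, (i < size s)%N -> forall f,
     in_ideal (G ++ take i s) (s`_i * f) -> in_ideal (G ++ take i s) f) /\
  ~ in_ideal (G ++ s) 1.

End Quotient.

(* From here on G is a list of homogeneous generators of an ideal I of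
   S = K[x_1, ..., x_n], and R = S/I is a standard graded K-algebra; its graded
   maximal ideal is generated by the classes of the variables, and its
   homogeneous elements of positive degree are the classes of those of S. *)
Section Graded.

Variables (n : nat) (K : fieldType).
Implicit Types G s : seq {mpoly K[n]}.

Definition pos_homog (f : {mpoly K[n]}) : Prop :=
  exists2 e : nat, (0 < e)%N & f \is e.-homog.

Definition homog_regular_seq G s : Prop :=
  {in s, forall f, pos_homog f} /\ regular_seq G s.

(* Depth of R with respect to its graded maximal ideal. *)
Definition has_depth G (t : nat) : Prop :=
  (exists2 s, homog_regular_seq G s & size s = t) /\
  (forall s, homog_regular_seq G s -> (size s <= t)%N).

Definition cohen_macaulay G : Prop :=
  (* the zero ring is Cohen-Macaulay by convention *)
  in_ideal G 1 \/ exists2 d, has_krull_dim G d & has_depth G d.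

Definition is_sop G s : Prop :=
  [/\ {in s, forall f, pos_homog f},
      has_krull_dim G (size s)
    & has_krull_dim (G ++ s) 0].

Definition variable_or_difference (f : {mpoly K[n]}) : Prop :=
  (exists i : 'I_n, f = 'X_i) \/
  (exists k i : 'I_n, k != i /\ f = 'X_k - 'X_i).

Definition special_sop G s : Prop :=
  is_sop G s /\ {in s, forall f, variable_or_difference f}.

End Graded.

Definition monomial_or_homog_binomial (n : nat) (f : {mpoly int[n]}) : Prop :=
  (exists u : 'X_{1..n}, f = 'X_[u]) \/
  (exists u v : 'X_{1..n}, mdeg u = mdeg v /\ f = 'X_[u] - 'X_[v]).

(* The coefficients of F lie in {0, 1, -1}, so F is given over int and read in
   K[x_1, ..., x_n] through the canonical map int -> K. *)
Definition over_field (n : nat) (K : fieldType) (F : seq {mpoly int[n]}) :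
    seq {mpoly K[n]} :=
  [seq map_mpoly (intr : int -> K) f | f <- F].

(* Main.v *)
Require Import Defs.
From HB Require Import structures.
From mathcomp Require Import all_boot all_order all_algebra.
From mathcomp Require Import ring_quotient.
From mathcomp Require Import boolp.
From mathcomp Require classical_sets.
From mathcomp Require Import zify ring.

(** Write R for the quotient by the ideal in question and s for the special system
    of parameters, of length d.  Two facts carry the proof.

    Over one field, R is Cohen-Macaulay if and only if s is a regular sequence.
    A regular s of finite colength pins down both dimension and depth: a
    nonzerodivisor in a prime leaves room for a smaller prime
    ([has_chain_nzd_seq]), and a chain of primes of length e forces the Hilbert
    function (the dimension of the part of degree at most M) to grow at least like
    the e-th power of M, while a homogeneous sequence of d elements with finite
    colength lets it grow at most like the d-th power
    ([chain_hilb], [hilb_growth], [chain_le_sop]).  Conversely, in a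
    Cohen-Macaulay ring every homogeneous system of parameters is regular
    ([sop_nzd_seq]).  The proof exchanges the terms of one sequence for those of
    the other: regular sequences of homogeneous elements of positive degree may
    be permuted ([nzd_swap]), a parameter of a one-dimensional Cohen-Macaulay
    ring is a nonzerodivisor ([nzd_exchange]), and two one-dimensional graded
    quotients have a common parameter ([common_parameter]), which the
    Cayley-Hamilton theorem produces over any field.

    Regularity of s is a property of Hilbert functions, which do not see the
    field.  A homogeneous f is a nonzerodivisor modulo an ideal if and only if
    the dimensions of the parts of bounded degree satisfy the equations of an
    exact sequence ([nzd_hspaceP]).  The variables and their differences are
    themselves monomials and binomials, so every ideal in sight is generated by monomials
    and homogeneous binomials, and its part of bounded degree is the span of the
    differences along the edges of a graph on the monomials and one extra vertex
    standing for 0.  The dimension of that span is determined by connectivity in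
    the graph ([edge_span_connect], [dim_edge_span]).

    Since the dimension of R over the second field is not given, it is recovered
    from the Hilbert function as well ([cohen_macaulay_binomials]). *)

Set Implicit Arguments.
Unset Strict Implicit.
Unset Printing Implicit Defensive.

Import GRing.Theory.
Local Open Scope ring_scope.

(** * Ideals given by generators, and regular sequences *)

Section IdealTheory.
Variable A : comNzRingType.
Implicit Types (G s : seq A) (P : {pred A}).

Definition is_ideal (J : A -> Prop) : Prop :=
  J 0 /\ forall a u v, J u -> J v -> J (a * u + v).

Lemma in_ideal_is_ideal G : is_ideal (in_ideal G).
Proof.
split; first by exists (fun=> 0); rewrite big1 // => i _; rewrite mul0r.
move=> a u v [c ->] [d ->]; exists (fun i => a * c i + d i).
rewrite mulr_sumr -big_split /=; apply: eq_bigr => i _.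
by rewrite mulrDl mulrA.
Qed.

Lemma in_ideal0 G : in_ideal G 0. Proof. exact: (in_ideal_is_ideal G).1. Qed.

Lemma in_idealMl G a u : in_ideal G u -> in_ideal G (a * u).
Proof.
by move=> Gu; rewrite -[_ * _]addr0; apply: (in_ideal_is_ideal G).2 => //; apply: in_ideal0.
Qed.

Lemma in_idealMr G a u : in_ideal G u -> in_ideal G (u * a).
Proof. by rewrite mulrC; apply: in_idealMl. Qed.

Lemma in_idealD G u v : in_ideal G u -> in_ideal G v -> in_ideal G (u + v).
Proof. by move=> Gu Gv; rewrite -[u]mul1r; apply: (in_ideal_is_ideal G).2. Qed.

Lemma in_idealN G u : in_ideal G u -> in_ideal G (- u).
Proof. by move=> Gu; rewrite -mulN1r; apply: in_idealMl. Qed.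

Lemma in_idealB G u v : in_ideal G u -> in_ideal G v -> in_ideal G (u - v).
Proof. by move=> Gu Gv; apply/in_idealD/in_idealN. Qed.

Lemma in_ideal_sum G (I : Type) (r : seq I) (p : pred I) (F : I -> A) :
  (forall i, p i -> in_ideal G (F i)) -> in_ideal G (\sum_(i <- r | p i) F i).
Proof. by move=> GF; apply: big_ind => //; [apply: in_ideal0 | apply: in_idealD]. Qed.

Lemma in_ideal_mem G g : g \in G -> in_ideal G g.
Proof.
move=> Gg; have ltG : (index g G < size G)%N by rewrite index_mem.
exists (fun i => (i == Ordinal ltG)%:R).
rewrite (bigD1 (Ordinal ltG)) //= eqxx mul1r nth_index // big1 ?addr0 //.
by move=> i /negbTE->; rewrite mul0r.
Qed.

Lemma in_ideal_min G (J : A -> Prop) :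
  is_ideal J -> {in G, forall g, J g} -> forall f, in_ideal G f -> J f.
Proof.
move=> [J0 JD] GJ _ [c ->]; apply: (big_ind J) => // [u v Ju Jv|i _].
  by rewrite -[u]mul1r; apply: JD.
by rewrite -[_ * _]addr0; apply: JD => //; apply: GJ; apply: mem_nth.
Qed.

Lemma in_ideal_gen G G' : {in G, forall g, in_ideal G' g} ->
  forall f, in_ideal G f -> in_ideal G' f.
Proof. by move=> GG'; apply: in_ideal_min => //; apply: in_ideal_is_ideal. Qed.

Lemma in_ideal_sub G G' : {subset G <= G'} -> forall f, in_ideal G f -> in_ideal G' f.
Proof. by move=> GG'; apply: in_ideal_gen => g /GG'; apply: in_ideal_mem. Qed.

Lemma in_ideal_catl G s f : in_ideal G f -> in_ideal (G ++ s) f.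
Proof. by apply: in_ideal_sub => g; rewrite mem_cat => ->. Qed.

Lemma in_ideal_cat1 G x f :
  in_ideal (G ++ [:: x]) f <-> exists2 g, in_ideal G g & exists h, f = g + h * x.
Proof.
split=> [|[g Gg [h ->]]]; last first.
  apply: in_idealD; first exact: in_ideal_catl.
  by apply/in_idealMl/in_ideal_mem; rewrite mem_cat mem_head orbT.
apply: (@in_ideal_min _ (fun f => exists2 g, in_ideal G g & exists h, f = g + h * x)) => [|g].
  split; first by exists 0; [apply: in_ideal0 | exists 0; rewrite mul0r addr0].
  move=> a _ _ [g1 Gg1 [h1 ->]] [g2 Gg2 [h2 ->]]; exists (a * g1 + g2).
    exact: (in_ideal_is_ideal G).2.
  by exists (a * h1 + h2); ring.
rewrite mem_cat inE => /orP[Gg|/eqP->].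
  by exists g; [apply: in_ideal_mem | exists 0; rewrite mul0r addr0].
by exists 0; [apply: in_ideal0 | exists 1; rewrite mul1r add0r].
Qed.

Definition nzd G x : Prop := forall f, in_ideal G (x * f) -> in_ideal G f.

(** Recursion on the sequence replaces the indices and prefixes of [regular_seq]
    and leaves out properness of the final ideal; see [regular_seqP]. *)
Fixpoint nzd_seq G s : Prop :=
  if s is x :: s' then nzd G x /\ nzd_seq (G ++ [:: x]) s' else True.

Definition eq_ideal G G' : Prop := forall f, in_ideal G f <-> in_ideal G' f.

Lemma eq_mem_ideal G G' : G =i G' -> eq_ideal G G'.
Proof. by move=> GG' f; split; apply: in_ideal_sub => g; rewrite GG'. Qed.

Lemma eq_ideal_cat G G' s : eq_ideal G G' -> eq_ideal (G ++ s) (G' ++ s).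
Proof.
by move=> GG' f; split; apply: in_ideal_gen => g; rewrite mem_cat => /orP[|] gin;
  do ?[by apply/in_ideal_catl/GG'/in_ideal_mem];
  apply: in_ideal_mem; rewrite mem_cat gin orbT.
Qed.

Lemma eq_ideal_nzd G G' x : eq_ideal G G' -> nzd G x -> nzd G' x.
Proof. by move=> GG' Gx f /GG' /Gx /GG'. Qed.

Lemma eq_ideal_nzd_seq G G' s : eq_ideal G G' -> nzd_seq G s -> nzd_seq G' s.
Proof.
elim: s G G' => //= x s IHs G G' GG' [Gx Gs]; split; first exact: eq_ideal_nzd Gx.
exact: IHs (eq_ideal_cat _ GG') Gs.
Qed.

Lemma nzd_seq_cat G s s' :
  nzd_seq G (s ++ s') <-> nzd_seq G s /\ nzd_seq (G ++ s) s'.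
Proof.
elim: s G => [|x s IHs] G /=; first by rewrite cats0; split=> [|[]].
by rewrite IHs -catA /=; split=> [[? []]|[[]]].
Qed.

Lemma nzd_seq_rcons G s x :
  nzd_seq G (rcons s x) <-> nzd_seq G s /\ nzd (G ++ s) x.
Proof. by rewrite -cats1 nzd_seq_cat /=; split=> [[? []]|[]]. Qed.

Lemma regular_seqP G s : regular_seq G s <-> nzd_seq G s /\ ~ in_ideal (G ++ s) 1.
Proof.
suff nzdP : (forall i, (i < size s)%N -> nzd (G ++ take i s) s`_i) <-> nzd_seq G s.
  by split=> -[/nzdP].
elim: s G => [|x s IHs] G; first by split.
split=> [Gs | /= [Gx /IHs Gs]].
  split; first by have := Gs 0%N isT; rewrite take0 cats0.
  by apply/IHs => i lti; have := Gs i.+1 lti; rewrite /= -catA.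
by case=> [_|i /Gs]; rewrite /= ?cats0 // -catA.
Qed.

End IdealTheory.

(** * Chains of primes from regular sequences *)

Section PrimeTheory.
Variable A : comNzRingType.
Implicit Types (G s : seq A) (P : {pred A}).

(** Zorn's lemma yields a set [X] maximal among those generating, together with
    [G], an ideal disjoint from [M]; maximality makes [X] a prime ideal.  The
    condition is put on all finite parts of [X] so that it holds for the empty
    set and passes to unions of chains without [X] being an ideal beforehand. *)
Lemma prime_avoiding G (M : A -> Prop) :
    M 1 -> (forall f g, M f -> M g -> M (f * g)) ->
    (forall f, M f -> ~ in_ideal G f) ->
  exists P, [/\ prime_ideal P, {subset G <= P} & forall f, M f -> f \notin P].
Proof.
move=> M1 MM MG.
pose avoids (X : A -> Prop) :=
  forall l : seq A, {in l, forall g, X g} -> forall f, M f -> ~ in_ideal (G ++ l) f.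
have [|X [Xav Xmax]] := @classical_sets.Zorn_bigcup A avoids.
  move=> F Fav Ftot l lF.
  have [->|[X FX lX]] : l = [::] \/ exists2 X, F X & {in l, forall g, X g}.
    elim: l lF => [|g l IHl] lF; [by left | right].
    have [X FX Xg] : exists2 X, F X & X g.
      by have [X FX Xg] := lF g (mem_head _ _); exists X.
    have [|l0|[Y FY lY]] := IHl.
    - by move=> h lh; apply: lF; rewrite inE lh orbT.
    - by exists X => // h; rewrite l0 inE => /eqP->.
    have [XY|YX] := Ftot _ _ FX FY.
      by exists Y => // h; rewrite inE => /orP[/eqP->|/lY//]; apply: XY.
    by exists X => // h; rewrite inE => /orP[/eqP->//|/lY]; apply: YX.
  - by rewrite cats0.
  by move=> f; apply: Fav lX f.
(* Maximality: adjoining an element outside X makes the ideal meet M. *)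
have Xex g : ~ X g -> exists l f, [/\ {in l, forall h, X h}, M f
    & in_ideal (G ++ l ++ [:: g]) f].
  move=> nXg; apply: contrapT => noex.
  case: (Xmax (fun h => X h \/ h = g)).
    split; first by move=> h; left.
    by move=> /(_ g (or_intror erefl)).
  move=> l lX f Mf lf; apply: noex.
  exists [seq h <- l | h != g], f; split=> // [h|].
    by rewrite mem_filter => /andP[/eqP ngh /lX[]].
  apply: in_ideal_sub lf => h; rewrite !mem_cat mem_filter inE.
  by case: (h == g); rewrite ?orbT //= orbF.
have Xcl l f : {in l, forall h, X h} -> in_ideal (G ++ l) f -> X f.
  move=> lX lf; apply: contrapT => /Xex[l' [g [lX' Mg gin]]].
  apply: (Xav (l ++ l') _ _ Mg).
    by move=> h; rewrite mem_cat => /orP[/lX|/lX'].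
  apply: in_ideal_gen gin => h; rewrite !mem_cat inE => /or3P[hin|hin|/eqP->].
  - by apply: in_ideal_mem; rewrite mem_cat hin.
  - by apply: in_ideal_mem; rewrite !mem_cat hin !orbT.
  by rewrite catA; apply: in_ideal_catl.
have X0 : X 0 by apply: (Xcl [::]) => //; apply: in_ideal0.
have XD a u v : X u -> X v -> X (a * u + v).
  move=> Xu Xv; apply: (Xcl [:: u; v]).
    by move=> h; rewrite !inE => /orP[]/eqP->.
  by apply: (in_ideal_is_ideal _).2; apply: in_ideal_mem; rewrite mem_cat !inE eqxx ?orbT.
have XN f : M f -> ~ X f.
  move=> Mf Xf; apply: (Xav [:: f] _ f Mf) => [h|]; first by rewrite inE => /eqP->.
  by apply: in_ideal_mem; rewrite mem_cat mem_head orbT.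
exists (fun f => `[< X f >]); split.
- split; first split.
  + exact/asboolP.
  + by apply/asboolP/XN.
  + by move=> a u v /asboolP Xu /asboolP Xv; apply/asboolP/XD.
  move=> u v /asboolP Xuv; apply: contrapT => /negP; rewrite negb_or.
  move=> /andP[/asboolP /Xex[l1 [f1 [lX1 Mf1 fin1]]] /asboolP /Xex[l2 [f2 [lX2 Mf2 fin2]]]].
  move: fin1 fin2; rewrite !catA => /in_ideal_cat1[g1 gin1 [h1 def1]].
  move=> /in_ideal_cat1[g2 gin2 [h2 def2]].
  apply: (XN (f1 * f2)); first exact: MM.
  have Xg1 := Xcl _ _ lX1 gin1; have Xg2 := Xcl _ _ lX2 gin2.
  rewrite def1 def2.
  have ->: (g1 + h1 * u) * (g2 + h2 * v)
         = (g2 + h2 * v) * g1 + ((h1 * u) * g2 + ((h1 * h2) * (u * v) + 0)) by ring.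
  exact: (XD _ _ _ Xg1 (XD _ _ _ Xg2 (XD _ _ _ Xuv X0))).
- by move=> g Gg; apply/asboolP; apply: (Xcl [::]) => //; rewrite cats0; apply: in_ideal_mem.
by move=> f /XN nXf; apply/asboolP.
Qed.

Lemma in_ideal_prime P G f : prime_ideal P -> {subset G <= P} -> in_ideal G f -> f \in P.
Proof.
by move=> [[P0 _ PD] _] GP; apply: (@in_ideal_min _ _ (fun f => f \in P)).
Qed.

(** The multiplicative set of the [x ^+ k * u] with [u] outside [P] misses the
    ideal: cancelling the powers of the nonzerodivisor [x] would put [u] in [P].
    A prime avoiding that set avoids [x] and lies in [P]. *)
Lemma prime_below_nzd P G x : prime_ideal P -> {subset G ++ [:: x] <= P} -> nzd G x ->
  exists Q, [/\ prime_ideal Q, {subset G <= Q}, {subset Q <= P} & x \notin Q].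
Proof.
move=> prP GP Gx.
have P1 : 1 \notin P by case: prP => -[].
pose M f := exists k u, u \notin P /\ f = x ^+ k * u.
have [|f g [k [u [Pu ->]]] [l [v [Pv ->]]]|f [k [u [Pu ->]]]|Q [prQ GQ MQ]] :=
  @prime_avoiding G M.
- by exists 0%N, 1; split; rewrite // expr0 mulr1.
- exists (k + l)%N, (u * v); split; last by rewrite exprD; ring.
  by apply/negP => /(proj2 prP); rewrite (negbTE Pu) (negbTE Pv).
- elim: k => [|k IHk] Gxu; last by apply: IHk; apply: Gx; rewrite mulrA -exprS.
  case/negP: Pu; apply: (in_ideal_prime prP) (_ : in_ideal G u).
    by move=> g Gg; apply: GP; rewrite mem_cat Gg.
  by move: Gxu; rewrite expr0 mul1r.
exists Q; split=> //.
  by move=> f Qf; apply: contraLR Qf => Pf; apply: MQ; exists 0%N, f; rewrite expr0 mul1r.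
by apply: MQ; exists 1%N, 1; rewrite mulr1 expr1.
Qed.

Definition has_chain G e := exists Ps, prime_chain G e Ps.

Lemma has_chain0 G : ~ in_ideal G 1 -> has_chain G 0.
Proof.
move=> G1; have [| |f ->//|P [prP GP _]] := @prime_avoiding G (fun f => f = 1).
- by [].
- by move=> f g -> ->; rewrite mulr1.
by exists (fun=> P); split.
Qed.

Lemma has_chain_proper G e : has_chain G e -> ~ in_ideal G 1.
Proof.
move=> [P [Ppr _]]; have [prP GP] := Ppr 0%N isT.
by move=> /(in_ideal_prime prP GP); apply/negP; case: prP => -[].
Qed.

(** Each term of a regular sequence lets the chain be extended downwards by one
    prime, so depth never exceeds dimension. *)
Lemma has_chain_nzd_seq G s e :
  nzd_seq G s -> has_chain (G ++ s) e -> has_chain G (e + size s).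
Proof.
elim: s G => [|x s IHs] G /=; first by rewrite cats0 addn0.
move=> [Gx Gs]; rewrite -cat1s catA => /(IHs _ Gs)[P [Ppr Plt]].
have [prP GP] := Ppr 0%N isT.
have [Q [prQ GQ QP xQ]] := prime_below_nzd prP GP Gx.
rewrite addnS; exists (fun i => if i is i'.+1 then P i' else Q); split.
  case=> [|i] lti //; have [prPi GPi] := Ppr i lti; split=> // g Gg.
  by apply: GPi; rewrite mem_cat Gg.
case=> [|i] lti; last exact: Plt.
split=> // /(_ x) PQ; case/negP: xQ; apply: PQ.
by apply: GP; rewrite mem_cat mem_head orbT.
Qed.

End PrimeTheory.

(** * Homogeneous ideals and exchange of regular elements *)

Section GradedTheory.
Variables (n : nat) (K : fieldType).
Implicit Types (G s : seq {mpoly K[n]}) (f g x y t : {mpoly K[n]}).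

Definition homog_gens G : Prop := {in G, forall g, exists e, g \is e.-homog}.

Definition pos_homogs s : Prop := {in s, forall x, pos_homog x}.

Lemma homog_gens_cat G s : homog_gens G -> homog_gens s -> homog_gens (G ++ s).
Proof. by move=> Gh sh g; rewrite mem_cat => /orP[/Gh|/sh]. Qed.

Lemma pos_homogs_gens s : pos_homogs s -> homog_gens s.
Proof. by move=> sh g /sh[e _ ge]; exists e. Qed.

Lemma pos_homogs_cons x s : pos_homogs (x :: s) <-> pos_homog x /\ pos_homogs s.
Proof.
split=> [sh|[xh sh] y]; last by rewrite inE => /orP[/eqP->|/sh].
by split=> [|y sy]; apply: sh; rewrite inE ?eqxx ?sy ?orbT.
Qed.

Lemma pos_homogs_rcons x s : pos_homogs (rcons s x) <-> pos_homog x /\ pos_homogs s.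
Proof.
split=> [sh|[xh sh] y]; last by rewrite mem_rcons inE => /orP[/eqP->|/sh].
by split=> [|y sy]; apply: sh; rewrite mem_rcons inE ?eqxx ?sy ?orbT.
Qed.

Lemma homog_gens1 x : pos_homog x -> homog_gens [:: x].
Proof. by move=> xh; apply: pos_homogs_gens; apply/pos_homogs_cons. Qed.

Lemma pihomogM d e f g : g \is e.-homog ->
  pihomog mdeg (d + e) (f * g) = pihomog mdeg d f * g.
Proof.
move=> ge; rewrite {1 2}[f]mpolyE mulr_suml !linear_sum mulr_suml; apply: eq_bigr => u _ /=.
rewrite -scalerAl !linearZ -scalerAl /=; congr (_ *: _).
have uge : 'X_[u] * g \is (mdeg u + e).-homog by apply: dhomogM; rewrite ?dhomogX.
rewrite pihomogX; case: eqP => [<-|ned]; first by rewrite pihomog_dE.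
by rewrite mul0r (pihomog_ne0 _ uge) // eqn_add2r; apply/eqP.
Qed.

Lemma pihomogM_lt d e f g : g \is e.-homog -> (d < e)%N -> pihomog mdeg d (f * g) = 0.
Proof.
move=> ge ltde; rewrite [f]mpolyE mulr_suml !linear_sum big1 // => u _.
have uge : 'X_[u] * g \is (mdeg u + e).-homog by apply: dhomogM; rewrite ?dhomogX.
rewrite -scalerAl linearZ /= (pihomog_ne0 _ uge) ?scaler0 //.
by rewrite gtn_eqF // (leq_trans ltde) // leq_addl.
Qed.

Lemma in_ideal_pihomog G f d : homog_gens G -> in_ideal G f ->
  in_ideal G (pihomog mdeg d f).
Proof.
move=> Gh [c ->]; rewrite linear_sum; apply: in_ideal_sum => i _ /=.
have Gi : G`_i \in G by apply: mem_nth.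
have [e ge] := Gh _ Gi; have [ltde|leed] := ltnP d e.
  by rewrite (pihomogM_lt _ ge) //; apply: in_ideal0.
by rewrite -(subnK leed) (pihomogM _ _ ge); apply/in_idealMl/in_ideal_mem.
Qed.

Lemma in_ideal_pihomogs G f : (forall d, in_ideal G (pihomog mdeg d f)) -> in_ideal G f.
Proof.
move=> Gf; rewrite (pihomog_partitionE (leqnn (msize f))).
by apply: in_ideal_sum => d _.
Qed.

Lemma in_ideal_msupp G f : {in msupp f, forall u, in_ideal G 'X_[u]} -> in_ideal G f.
Proof.
move=> Gf; rewrite [f]mpolyE big_seq; apply: in_ideal_sum => u fu.
by rewrite -mul_mpolyC; apply/in_idealMl/Gf.
Qed.

(** If [b * f] is in the ideal of [G] then [f] is [h * a] modulo [G] and again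
    [b * h] is in the ideal; iterating, [f] lies in the ideal of [G] and [a ^+ k]
    for every [k].  As [a] has positive degree, this forces each homogeneous
    component of [f] into the ideal of [G] (graded Nakayama).  The second claim is a
    formal consequence of the regularity of the sequence [a, b]. *)
Lemma nzd_swap G a b : homog_gens G -> pos_homog a -> nzd G a -> nzd (G ++ [:: a]) b ->
  nzd G b /\ nzd (G ++ [:: b]) a.
Proof.
move=> Gh [e e0 ae] Ga Gb.
have Gb' : nzd G b.
  move=> f bf; suff fa k : exists2 g, in_ideal G g &
      exists2 h, f = g + h * a ^+ k & in_ideal G (b * h).
    apply: in_ideal_pihomogs => d; have [g Gg [h -> _]] := fa d.+1.
    rewrite raddfD /= (pihomogM_lt _ (dhomogMn _ ae)); last first.
      by rewrite (leq_trans (ltnSn d)) // leq_pmull.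
    by rewrite addr0; apply: in_ideal_pihomog.
  elim: k => [|k [g Gg [h -> bh]]].
    by exists 0; [apply: in_ideal0 | exists f; rewrite // expr0 mulr1 add0r].
  have /in_ideal_cat1[g' Gg' [h' def_h]] : in_ideal (G ++ [:: a]) h.
    by apply: Gb; apply: in_ideal_catl.
  exists (g + g' * a ^+ k); first by apply: in_idealD => //; apply: in_idealMr.
  exists h'; first by rewrite def_h exprS; ring.
  apply: Ga; have -> : a * (b * h') = b * h - b * g' by rewrite def_h; ring.
  by apply: in_idealB => //; apply: in_idealMl.
split=> // f /in_ideal_cat1[g Gg [h def_af]].
have /in_ideal_cat1[g' Gg' [h' def_h]] : in_ideal (G ++ [:: a]) h.
  apply: Gb; apply/in_ideal_cat1; exists (- g); first exact: in_idealN.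
  by exists f; rewrite (mulrC f) def_af; ring.
apply/in_ideal_cat1; exists (f - h' * b); last by exists h'; ring.
apply: Ga; have -> : a * (f - h' * b) = g + g' * b.
  by rewrite mulrBr def_af def_h; ring.
by apply: in_idealD => //; apply: in_idealMr.
Qed.

Lemma nzd_seq_cons_rcons G a s : homog_gens G -> pos_homog a -> pos_homogs s ->
  nzd_seq G (a :: s) -> nzd_seq G (rcons s a).
Proof.
elim: s G => [|b s IHs] G //= Gh ah /pos_homogs_cons[bh sh] [Ga [Gb Gs]].
have [Gb' Ga'] := nzd_swap Gh ah Ga Gb; split=> //.
apply: IHs => //; first by apply: homog_gens_cat => //; apply: homog_gens1.
split=> //; apply: eq_ideal_nzd_seq Gs; rewrite -!catA; apply: eq_mem_ideal => g.
by rewrite !mem_cat !inE; congr (_ || _); apply: orbC.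
Qed.

Lemma nzd_seq_rcons_cons G a s : homog_gens G -> pos_homog a -> pos_homogs s ->
  nzd_seq G (rcons s a) -> nzd_seq G (a :: s).
Proof.
elim: s G => [|b s IHs] G //= Gh ah /pos_homogs_cons[bh sh] [Gb Gsa].
have Gbh : homog_gens (G ++ [:: b]) by apply: homog_gens_cat => //; apply: homog_gens1.
have [Ga Gs] := IHs _ Gbh ah sh Gsa.
have [Ga' Gb'] := nzd_swap Gh bh Gb Ga; do 2!split=> //.
apply: eq_ideal_nzd_seq Gs; rewrite -!catA; apply: eq_mem_ideal => g.
by rewrite !mem_cat !inE; congr (_ || _); apply: orbC.
Qed.

(** For homogeneous [G]: the quotient by [G] is finite-dimensional, that is, zero in
    all large degrees. *)
Definition cofinite G : Prop :=
  exists m, forall u, (m <= mdeg u)%N -> in_ideal G 'X_[u].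

Lemma cofinite_gen G G' : {in G, forall g, in_ideal G' g} -> cofinite G -> cofinite G'.
Proof. by move=> GG' [m Gm]; exists m => u /Gm; apply: in_ideal_gen. Qed.

Lemma submnm_deg m (u : 'X_{1..n}) : (m <= mdeg u)%N ->
  exists2 v, (v <= u)%MM & mdeg v = m.
Proof.
move=> lemu; have [k] := ubnP (mdeg u - m); elim: k u lemu => // k IHk u lemu.
rewrite ltnS => lek; have [->|ltmu] := eqVneq m (mdeg u).
  by exists u; rewrite ?lepm_refl.
have u0 : u != 0%MM by apply: contraNneq ltmu => u0; move: lemu; rewrite u0 mdeg0 leqn0.
have [i ui] : exists i, u i != 0%N.
  apply/existsP; apply: contraNT u0; rewrite negb_exists => /forallP u0.
  by apply/eqP/mnmP => i; rewrite mnm0E; apply/eqP; rewrite -[_ == _]negbK.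
have defu : mdeg u = (mdeg (u - U_(i))).+1.
  by rewrite -[in LHS](submK (_ : (U_(i) <= u)%MM)) ?lep1mP // mdegD mdeg1 addn1.
have [||v vu vm] := IHk (u - U_(i))%MM; try lia.
by exists v => //; apply: lepm_trans vu (lem_subr _ _).
Qed.

Lemma cofinite_deg G m : (forall u, mdeg u = m -> in_ideal G 'X_[u]) -> cofinite G.
Proof.
move=> Gm; exists m => u /submnm_deg[v vu vm].
by rewrite -(submK vu) mpolyXD; apply/in_idealMl/Gm.
Qed.

Lemma cofinite_homog G : cofinite G ->
  exists m, forall d f, (m <= d)%N -> f \is d.-homog -> in_ideal G f.
Proof.
move=> [m Gm]; exists m => d f lemd fd; apply: in_ideal_msupp => u fu.
by apply: Gm; rewrite (dhomog_mf fd).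
Qed.

Lemma cofinite_pow G y : cofinite G -> pos_homog y -> exists N, in_ideal G (y ^+ N).
Proof.
move=> /cofinite_homog[m Gm] [e e0 ye]; exists m.
by apply: (Gm (e * m)%N); rewrite ?leq_pmull //; apply: dhomogMn.
Qed.

Lemma nzd_pow G x k : nzd G x -> nzd G (x ^+ k).
Proof.
move=> Gx; elim: k => [|k IHk] f; first by rewrite expr0 mul1r.
by rewrite exprS -mulrA => /Gx /IHk.
Qed.

(** A power of [t] is [h * y] modulo [G], so whatever [y] kills is killed by a
    power of the nonzerodivisor [t].  This is the one-dimensional case of the
    statement that every parameter of a Cohen-Macaulay ring is regular. *)
Lemma nzd_exchange G t y : pos_homog t -> nzd G t -> cofinite (G ++ [:: y]) -> nzd G y.
Proof.
move=> th Gt /cofinite_pow/(_ th)[N /in_ideal_cat1[g Gg [h def_t]]] f Gyf.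
apply: (nzd_pow (k := N) Gt); rewrite def_t mulrDl; apply: in_idealD; first exact: in_idealMr.
by rewrite -mulrA; apply: in_idealMl.
Qed.

(** Otherwise the ideal would contain a power ['X_i ^+ k i] of each variable,
    and every monomial of degree greater than the sum of the [k i] would be
    divisible by one of them. *)
Lemma not_cofinite_var G : ~ cofinite G -> exists i, forall k, ~ in_ideal G ('X_i ^+ k).
Proof.
move=> Gnc; apply: contrapT => /forallNP noi; apply: Gnc.
have /choice[k Gk] : forall i : 'I_n, exists k, in_ideal G ('X_i ^+ k).
  by move=> i; have /existsNP[k /contrapT ?] := noi i; exists k.
exists (\sum_i k i)%N.+1 => u leu.
have [i lti] : exists i, (k i < u i)%N.
  apply: contrapT => /forallNP leui; move: leu; apply/negP; rewrite -leqNgt mdegE.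
  by apply: leq_sum => i _; rewrite leqNgt; apply/negP/leui.
rewrite mpolyXE_id (bigD1 i) //= -(subnK (ltnW lti)) exprD -mulrA.
by apply/in_idealMl/in_idealMr/Gk.
Qed.

Lemma mcoeff_pihomog d f u : (pihomog mdeg d f)@_u = if mdeg u == d then f@_u else 0.
Proof.
have [ud|ud] := eqVneq; last by rewrite (dhomog_nemf_coeff (pihomogP _ _ _) ud).
rewrite pihomogE [in RHS](mpolyE f) !linear_sum big_mkcond /=; apply: eq_bigr => v _.
case: eqP => // nvd; rewrite mcoeffZ mcoeffX; case: eqP => [vu|_]; last by rewrite mulr0.
by case: nvd; rewrite vu.
Qed.

Lemma pihomog00 f : pihomog mdeg 0 f = (f@_0)%:MP.
Proof.
apply/mpolyP => u; rewrite mcoeff_pihomog mcoeffC mdeg_eq0.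
by case: eqP => [->|_]; rewrite ?mulr1 ?mulr0.
Qed.

(** The upper prime is the ideal [m] of the polynomials without constant term.
    The lower one avoids the products of a power of ['X_i] and a polynomial
    outside [m]; homogeneity of [G] reduces the disjointness of this
    multiplicative set from the ideal to the powers of ['X_i] themselves. *)
Lemma not_cofinite_chain G : homog_gens G -> ~ cofinite G -> has_chain G 1.
Proof.
move=> Gh Gnc; have [i Gi] := not_cofinite_var Gnc.
have XiG k f : in_ideal G ('X_i ^+ k * f) -> f@_0 = 0.
  move=> /(in_ideal_pihomog k Gh); rewrite mulrC -[k in pihomog _ k]add0n.
  have -> : pihomog mdeg (0 + k) (f * 'X_i ^+ k) = pihomog mdeg 0 f * 'X_i ^+ k.
    apply: pihomogM; rewrite -[X in X.-homog]mul1n.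
    by apply: dhomogMn; rewrite dhomogX /= mdeg1.
  rewrite pihomog00 => Gf; apply: contrapT => /eqP f0; apply: (Gi k).
  have := in_idealMl (f@_0)^-1%:MP Gf.
  by rewrite mulrA -mpolyCM mulVf // mpolyC1 mul1r.
pose m : {pred {mpoly K[n]}} := fun f => f@_0 == 0.
have prm : prime_ideal m.
  split; first split; rewrite ?unfold_in /m ?mcoeff0 ?mcoeff1 ?eqxx ?oner_eq0 //.
    by move=> a u v; rewrite !unfold_in => /eqP u0 /eqP v0;
       rewrite mcoeffD rmorphM /= u0 v0 mulr0 addr0.
  by move=> u v; rewrite !unfold_in rmorphM /= mulf_eq0.
have Gm : {subset G <= m}.
  by move=> g Gg; apply/eqP/(XiG 0); rewrite expr0 mul1r; apply: in_ideal_mem.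
pose M f := exists k u, u \notin m /\ f = 'X_i ^+ k * u.
have [|f g [k [u [mu ->]]] [l [v [mv ->]]]|f [k [u [mu ->]]]|Q [prQ GQ MQ]] :=
  @prime_avoiding _ G M.
- by exists 0%N, 1; split; [case: prm => -[] | rewrite expr0 mulr1].
- exists (k + l)%N, (u * v); split; last by rewrite exprD; ring.
  by apply/negP => /(proj2 prm); rewrite (negbTE mu) (negbTE mv).
- by move=> /XiG u0; case/eqP: mu.
exists (fun j => if j is 0 then Q else m); split; first by case.
case=> // _; split.
  by move=> f Qf; apply: contraLR Qf => mf; apply: MQ; exists 0%N, f; rewrite expr0 mul1r.
have XQ : 'X_i \notin Q.
  by apply: MQ; exists 1%N, 1; split; [case: prm => -[] | rewrite expr1 mulr1].
move=> /(_ 'X_i) mQ; case/negP: XQ; apply: mQ.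
by rewrite unfold_in /m mcoeffX mnm1_eq0.
Qed.

End GradedTheory.

(** * Common parameters and regularity of systems of parameters *)

Section BinaryForm.
Variables (K : fieldType) (R : comAlgType K).
Implicit Types (x z : R) (d : nat) (e : nat -> K).

(** Formally [z ^+ d] times the polynomial with coefficients [e] at [x / z]. *)
Definition binary_form x z d e : R := \sum_(k < d.+1) e k *: (x ^+ k * z ^+ (d - k)).

Lemma binary_form_rev x z d e :
  binary_form x z d e = binary_form z x d (fun k => e (d - k)%N).
Proof.
rewrite /binary_form (reindex_inj rev_ord_inj) /=; apply: eq_bigr => k _.
by rewrite subSS subKn ?leq_ord // mulrC.
Qed.

End BinaryForm.

Section CommonParameter.
Variables (n : nat) (K : fieldType).
Implicit Types (G : seq {mpoly K[n]}) (f g x y z : {mpoly K[n]}).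

Lemma binary_form_homog x z d (e : nat -> K) c : x \is c.-homog -> z \is c.-homog ->
  binary_form x z d e \is (c * d).-homog.
Proof.
move=> xc zc; apply: rpred_sum => k _; apply/rpredZ.
by rewrite -[in (c * d)%N](subnKC (leq_ord k)) mulnDr; apply: dhomogM; apply: dhomogMn.
Qed.

Section Acts.
Variables (G : seq {mpoly K[n]}) (z : {mpoly K[n]}) (N : nat) (b : 'I_N.+1 -> {mpoly K[n]}).

Definition row_comb (M : 'M[K]_N.+1) i : {mpoly K[n]} := \sum_j M i j *: b j.

(** On the quotient by [G], multiplication by [f] on the span of [b] is [z ^+ p]
    times the matrix [M]: a way to speak of the operator [f / z ^+ p] on a
    graded piece without forming the quotient or inverting [z]. *)
Definition acts_as f p M : Prop :=
  forall i, in_ideal G (f * b i - z ^+ p * row_comb M i).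

Lemma row_combM M M' i : row_comb (M * M') i = \sum_j M i j *: row_comb M' j.
Proof.
rewrite /row_comb; under [RHS]eq_bigr => j _ do rewrite scaler_sumr.
rewrite exchange_big /=; apply: eq_bigr => k _; rewrite mxE scaler_suml.
by apply: eq_bigr => j _; rewrite scalerA.
Qed.

Lemma row_comb1 i : row_comb 1 i = b i.
Proof.
rewrite /row_comb (bigD1 i) //= mxE eqxx scale1r big1 ?addr0 // => j nji.
by rewrite mxE eq_sym (negbTE nji) scale0r.
Qed.

Lemma in_idealZ c f : in_ideal G f -> in_ideal G (c *: f).
Proof. by move=> Gf; rewrite -mul_mpolyC; apply: in_idealMl. Qed.

Lemma acts_asM f p M g q M' : acts_as f p M -> acts_as g q M' ->
  acts_as (f * g) (p + q) (M' * M).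
Proof.
move=> fM gM' i.
have -> : f * g * b i - z ^+ (p + q) * row_comb (M' * M) i
  = f * (g * b i - z ^+ q * row_comb M' i)
    + z ^+ q * \sum_j M' i j *: (f * b j - z ^+ p * row_comb M j).
  have -> : \sum_j M' i j *: (f * b j - z ^+ p * row_comb M j)
      = f * row_comb M' i - z ^+ p * row_comb (M' * M) i.
    rewrite row_combM !mulr_sumr -sumrB; apply: eq_bigr => j _.
    by rewrite scalerBr !scalerAr.
  by rewrite exprD; ring.
apply: in_idealD; first exact: in_idealMl.
by apply/in_idealMl/in_ideal_sum => j _; apply: in_idealZ.
Qed.

Lemma acts_asD f g p M M' : acts_as f p M -> acts_as g p M' -> acts_as (f + g) p (M + M').
Proof.
move=> fM gM' i.
have -> : row_comb (M + M') i = row_comb M i + row_comb M' i.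
  by rewrite -big_split /=; apply: eq_bigr => j _; rewrite mxE scalerDl.
rewrite (_ : _ - _ = (f * b i - z ^+ p * row_comb M i)
  + (g * b i - z ^+ p * row_comb M' i)); last by ring.
exact: in_idealD.
Qed.

Lemma acts_asZ c f p M : acts_as f p M -> acts_as (c *: f) p (c *: M).
Proof.
move=> fM i; rewrite (_ : row_comb _ i = c *: row_comb M i).
  by rewrite -scalerAr -scalerAl -scalerBr; apply: in_idealZ.
by rewrite scaler_sumr; apply: eq_bigr => j _; rewrite mxE scalerA.
Qed.

Lemma acts_as0 p : acts_as 0 p 0.
Proof.
move=> i; rewrite /row_comb big1 => [|j _]; last by rewrite mxE scale0r.
by rewrite mul0r mulr0 subr0; apply: in_ideal0.
Qed.

Lemma acts_as_par p : acts_as (z ^+ p) p 1.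
Proof. by move=> i; rewrite row_comb1 subrr; apply: in_ideal0. Qed.

Lemma acts_asX x M k : acts_as x 1 M -> acts_as (x ^+ k) k (M ^+ k).
Proof.
move=> xM; elim: k => [|k IHk]; first by rewrite !expr0 -(expr0 z); apply: acts_as_par.
by rewrite exprSr -addn1 [M ^+ _]exprD addnC; rewrite mulrC; apply: acts_asM.
Qed.

Lemma acts_as_form x M d e : acts_as x 1 M ->
  acts_as (binary_form x z d e) d (\sum_(k < d.+1) e k *: M ^+ k).
Proof.
move=> xM; rewrite /binary_form; elim/big_ind2: _ => [|f M1 g M2|k _].
- exact: acts_as0.
- exact: acts_asD.
have := acts_asM (acts_asX k xM) (acts_as_par (d - k)).
by rewrite mul1r subnKC ?leq_ord //; apply: acts_asZ.
Qed.

End Acts.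

Definition homog_basis m N (b : 'I_N.+1 -> {mpoly K[n]}) : Prop :=
  (forall i, b i \is m.-homog) /\
  (forall h, h \is m.-homog -> exists c, h = \sum_i c i *: b i).

Lemma exists_homog_basis m : exists N b, @homog_basis m N b.
Proof.
pose us := [seq bmnm w | w <- enum {: 'X_{1..n < m.+1}}].
pose l : seq {mpoly K[n]} := [seq 'X_[u] | u <- us & mdeg u == m].
exists (size l), (fun i : 'I_(size l).+1 => l`_i); split=> [i|h hm].
  have [ltil|leli] := ltnP i (size l); last by rewrite nth_default ?dhomog0.
  have /mapP[u] := mem_nth 0 ltil.
  by rewrite mem_filter => /andP[um _] ->; rewrite dhomogX.
rewrite [h]mpolyE big_seq; elim/big_ind: _ => [|_ _ [c1 ->] [c2 ->]|u hu].
- by exists (fun=> 0); rewrite big1 // => i _; rewrite scale0r.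
- exists (fun i => c1 i + c2 i); rewrite -big_split /=.
  by apply: eq_bigr => i _; rewrite scalerDl.
have um := dhomog_mf hm hu.
have ul : 'X_[u] \in l.
  have ltum : (mdeg u < m.+1)%N by rewrite um.
  apply: map_f; rewrite mem_filter um eqxx.
  by apply: (map_f (@bmnm _ _)) (mem_enum _ (BMultinom ltum)).
have ltul : (index 'X_[u] l < (size l).+1)%N by rewrite ltnS index_size.
exists (fun i => h@_u * (i == Ordinal ltul)%:R).
rewrite (bigD1 (Ordinal ltul)) //= eqxx mulr1 nth_index // big1 ?addr0 // => i /negbTE->.
by rewrite mulr0 scale0r.
Qed.

(** Multiplication by [t] is onto in large degrees of the quotient by [G]: the form
    in which finite colength of [G ++ [:: t]] enters. *)
Definition divides_from G t e m0 : Prop := forall m f, (m0 <= m)%N ->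
  f \is (m + e).-homog -> exists2 h, h \is m.-homog & in_ideal G (f - h * t).

Lemma cofinite_divides G t e : homog_gens G -> t \is e.-homog -> cofinite (G ++ [:: t]) ->
  exists m0, divides_from G t e m0.
Proof.
move=> Gh te /cofinite_homog[m0 Gm]; exists m0 => m f lem fme.
have /in_ideal_cat1[g Gg [h def_f]] : in_ideal (G ++ [:: t]) f.
  by apply: (Gm (m + e)%N) => //; apply: (leq_trans lem); apply: leq_addr.
exists (pihomog mdeg m h); first exact: pihomogP.
rewrite -(pihomogM _ _ te) -(pihomog_dE fme) def_f raddfD /= addrK.
exact: in_ideal_pihomog.
Qed.

Lemma divides_iter G t e m0 k m f : divides_from G t e m0 -> (m0 <= m)%N ->
  f \is (m + e * k).-homog -> exists2 h, h \is m.-homog & in_ideal G (f - h * t ^+ k).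
Proof.
move=> Gt lem; elim: k f => [|k IHk] f fh.
  exists f; first by move: fh; rewrite muln0 addn0.
  by rewrite expr0 mulr1 subrr; apply: in_ideal0.
have [||g gh fg] := Gt (m + e * k)%N f.
- by rewrite (leq_trans lem) ?leq_addr.
- by rewrite -addnA -mulnSr.
have [h hm gh'] := IHk g gh; exists h => //.
rewrite (_ : _ - _ = (f - g * t) + (g - h * t ^+ k) * t); last by rewrite exprS; ring.
by apply: in_idealD => //; apply: in_idealMr.
Qed.

(** Division by [t] in large degrees turns multiplication by [x] into an
    endomorphism [x / t] of a graded piece. *)
Lemma exists_acts_as G t e m0 m N (b : 'I_N.+1 -> _) x : divides_from G t e m0 ->
    (m0 <= m)%N -> homog_basis m b -> x \is e.-homog ->
  exists A, acts_as G t b x 1 A.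
Proof.
move=> Gt lem [bm bspan] xe.
have /choice[c xb] : forall i, exists c : 'I_N.+1 -> K,
    in_ideal G (x * b i - t * \sum_j c j *: b j).
  move=> i; have [|h /bspan[c ->]] := Gt m (x * b i) lem.
    by rewrite addnC; apply: dhomogM.
  by exists c; rewrite [t * _]mulrC.
exists (\matrix_(i, j) c i j) => i; rewrite expr1 /row_comb.
by under eq_bigr => j _ do rewrite mxE.
Qed.

(** If [y / t ^+ a] is invertible on a graded piece on which division by [t] is
    possible, then [y] maps that piece onto the one that [t ^+ a] reaches.  The
    quotient by [G] and [y] vanishes in one degree, hence in all larger ones. *)
Lemma acts_as_cofinite G t e m0 m N (b : 'I_N.+1 -> _) y a M W : divides_from G t e m0 ->
    (m0 <= m)%N -> homog_basis m b -> acts_as G t b y a M -> W * M = 1 ->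
  cofinite (G ++ [:: y]).
Proof.
move=> Gt lem [bm bspan] yM WM; apply: (@cofinite_deg _ _ _ (m + e * a)) => u um.
have [|h /bspan[c ->] Gu] := @divides_iter _ _ _ _ a _ 'X_[u] Gt lem.
  by rewrite dhomogX /= um.
rewrite -[X in in_ideal _ X](subrK ((\sum_i c i *: b i) * t ^+ a)).
apply: in_idealD; first exact: in_ideal_catl.
rewrite mulr_suml; apply: in_ideal_sum => i _; rewrite -scalerAl; apply: in_idealZ.
rewrite -(row_comb1 b i) -WM row_combM mulr_suml; apply: in_ideal_sum => j _.
rewrite -scalerAl; apply: in_idealZ; apply/in_ideal_cat1.
exists (- (y * b j - t ^+ a * row_comb b M j)); first exact: in_idealN.
by exists (b j); ring.
Qed.

Lemma cofinite_catX G t k : cofinite (G ++ [:: t]) -> cofinite (G ++ [:: t ^+ k]).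
Proof.
move=> [m Gm]; exists (k * m)%N; elim: k => [|k IHk] u leu.
  rewrite expr0 -['X_[u]]mulr1; apply/in_idealMl/in_ideal_mem.
  by rewrite mem_cat mem_head orbT.
have [|v vu vm] := @submnm_deg n m u; first by rewrite (leq_trans _ leu) // leq_pmull.
rewrite -(submK vu) mpolyXD.
have /IHk/in_ideal_cat1[g Gg [h ->]] : (k * m <= mdeg (u - v))%N.
  move: leu; rewrite -{1}(submK vu) mdegD vm mulSn; lia.
have /Gm/in_ideal_cat1[g' Gg' [h' ->]] : (m <= mdeg v)%N by rewrite vm.
apply/in_ideal_cat1; exists (g * (g' + h' * t) + (h * t ^+ k) * g').
  by apply: in_idealD; [apply: in_idealMr | apply: in_idealMl].
by exists (h * h'); rewrite exprS; ring.
Qed.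

Lemma horner_mx_Xn N (M : 'M[K]_N.+1) k : horner_mx M 'X^k = M ^+ k.
Proof. by rewrite rmorphXn /= horner_mx_X. Qed.

Lemma horner_mx_sum N (M : 'M[K]_N.+1) d (p : {poly K}) : (size p <= d.+1)%N ->
  horner_mx M p = \sum_(k < d.+1) p`_k *: M ^+ k.
Proof.
move=> lepd; have {1}-> : p = \sum_(k < d.+1) p`_k *: 'X^k.
  rewrite -poly_def; apply/polyP => i; rewrite coef_poly.
  by case: ltnP => // /(leq_trans lepd)/(nth_default 0).
rewrite linear_sum; apply: eq_bigr => k _.
by rewrite linearZ /= horner_mx_Xn.
Qed.

(** On a graded piece of the quotient by [G1] let [A] be the operator [s / t], and
    on one of the quotient by [G2] let [B] be the operator [t / s].  The
    parameter is [y = t ^+ a + s * F * H], where [F] is the homogenized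
    characteristic polynomial of [A] and [H] the homogenization of
    [g0], that of [B] stripped of its factors ['X].  By Cayley-Hamilton [F] acts as zero on the first piece, so [y] acts as
    [t ^+ a].  On the second piece [y] acts as [s ^+ a * r(B)], where
    [r = 'X^a + g0 * f'], with [f'] the reversal of the characteristic polynomial
    of [A], is coprime to ['X] and to [g0], hence to the characteristic
    polynomial of [B].  This construction works over every field, while a
    combination [t + c * s] with a constant [c] can fail over a finite one. *)
Lemma common_parameter_eqdeg G1 G2 t s e : (0 < e)%N -> homog_gens G1 -> homog_gens G2 ->
    t \is e.-homog -> s \is e.-homog ->
    cofinite (G1 ++ [:: t]) -> cofinite (G2 ++ [:: s]) ->
  exists y, [/\ pos_homog y, cofinite (G1 ++ [:: y]) & cofinite (G2 ++ [:: y])].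
Proof.
move=> e0 Gh1 Gh2 te se /(cofinite_divides Gh1 te)[m1 Gt1] /(cofinite_divides Gh2 se)[m2 Gs2].
pose m := maxn m1 m2; have le1 : (m1 <= m)%N by apply: leq_maxl.
have le2 : (m2 <= m)%N by apply: leq_maxr.
have [N [b bm]] := exists_homog_basis m.
have [A sA] := exists_acts_as Gt1 le1 bm se.
have [B tB] := exists_acts_as Gs2 le2 bm te.
pose f := char_poly A; pose d := N.+1.
have size_f : size f = d.+1 by rewrite size_char_poly.
have [k [g0 g00 defg]] := multiplicity_XsubC (char_poly B) 0.
rewrite monic_neq0 ?char_poly_monic //= in g00; rewrite subr0 in defg.
pose c := size g0; pose a := (1 + d + c)%N.
pose F := binary_form s t d (fun i => f`_i).
pose H := binary_form t s c (fun i => g0`_i).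
exists (t ^+ a + s * F * H); split.
- exists (e * a)%N; first by rewrite muln_gt0 e0.
  apply: rpredD; first exact: dhomogMn.
  by rewrite !mulnDr muln1; do 2?[apply: dhomogM] => //; apply: binary_form_homog.
- have HM := acts_as_form c (fun i => g0`_(c - i)) sA; rewrite -binary_form_rev in HM.
  have FA := acts_as_form d (fun i => f`_i) sA.
  rewrite -horner_mx_sum ?size_f // Cayley_Hamilton in FA.
  have := acts_asM (acts_asM sA FA) HM; rewrite mul0r mulr0 => sFH.
  have := acts_asD (acts_as_par G1 t b a) sFH; rewrite addr0 => yA.
  exact: acts_as_cofinite Gt1 le1 bm yA (mulr1 1).
pose f' := \poly_(i < d.+1) f`_(d - i).
have f'B := acts_as_form d (fun i => f`_(d - i)) tB; rewrite -binary_form_rev in f'B.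
have HB := acts_as_form c (fun i => g0`_i) tB.
rewrite -horner_mx_sum // in HB.
have defM : \sum_(i < d.+1) f`_(d - i) *: B ^+ i = horner_mx B f'.
  rewrite (horner_mx_sum _ (size_poly _ _)); apply: eq_bigr => i _.
  by rewrite coef_poly ltn_ord.
rewrite defM in f'B.
have := acts_asM (acts_asM (acts_as_par G2 s b 1) f'B) HB; rewrite expr1 mulr1 => sFH.
have yB := acts_asD (acts_asX a tB) sFH.
pose r := 'X^a + g0 * f'.
have defr : B ^+ a + horner_mx B g0 * horner_mx B f' = horner_mx B r.
  by rewrite /r rmorphD /= horner_mx_Xn rmorphM.
rewrite defr in yB.
(* r is 'X^a modulo g0, and its constant coefficient is that of g0 because
   the characteristic polynomial of A is monic. *)
have cop : coprimep r (char_poly B).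
  rewrite defg coprimepMr coprimep_expr ?andbT.
    rewrite coprimep_sym /r addrC mulrC coprimep_addl_mul coprimep_expr //.
    by rewrite coprimepX.
  rewrite coprimepX /root hornerD hornerXn expr0n /= add0r hornerM mulf_neq0 //.
  by rewrite horner_coef0 coef_poly /= subn0 -[d]/(d.+1.-1) -size_f -lead_coefE
             (monicP (char_poly_monic _)) oner_eq0.
have /Bezout_eq1_coprimepP[[u v] /= uv1] := cop.
have WM : horner_mx B u * horner_mx B r = 1.
  by rewrite -rmorphM -(rmorph1 (horner_mx B)) -uv1 rmorphD !rmorphM /=
             Cayley_Hamilton mulr0 addr0.
exact: acts_as_cofinite Gs2 le2 bm yB WM.
Qed.

Lemma common_parameter G1 G2 t s : homog_gens G1 -> homog_gens G2 ->
    pos_homog t -> pos_homog s -> cofinite (G1 ++ [:: t]) -> cofinite (G2 ++ [:: s]) ->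
  exists y, [/\ pos_homog y, cofinite (G1 ++ [:: y]) & cofinite (G2 ++ [:: y])].
Proof.
move=> Gh1 Gh2 [e e0 te] [e' e'0 se] Gt Gs.
apply: (@common_parameter_eqdeg _ _ (t ^+ e') (s ^+ e) (e * e')) => //.
- by rewrite muln_gt0 e0.
- exact: dhomogMn.
- by rewrite mulnC; apply: dhomogMn.
- exact: cofinite_catX.
- exact: cofinite_catX.
Qed.

Lemma cofinite_catC G s s' : cofinite ((G ++ s) ++ s') -> cofinite ((G ++ s') ++ s).
Proof.
apply: cofinite_gen => g; rewrite !mem_cat -orbA [(g \in s) || _]orbC orbA => gin.
by apply: in_ideal_mem; rewrite !mem_cat.
Qed.

(** In a graded Cohen-Macaulay ring every homogeneous system of parameters is
    regular.  Induction on [d]: a common parameter [y] may replace the last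
    terms of both [s] and [t].  It is regular after the other terms of [t], so it
    can be moved to the front and divided out; the induction hypothesis makes
    the other terms of [s] regular modulo [y].  Moving [y] back to the end makes
    it regular after them, and then so is the last term of [s]. *)
Lemma sop_nzd_seq d G s t : homog_gens G -> pos_homogs s -> pos_homogs t ->
    size s = d -> size t = d -> nzd_seq G t -> cofinite (G ++ t) -> cofinite (G ++ s) ->
  nzd_seq G s.
Proof.
elim: d G s t => [|d IHd] G s t Gh; first by case: s.
case/lastP: s => // s sd; case/lastP: t => // t td.
move=> /pos_homogs_rcons[sdh sh] /pos_homogs_rcons[tdh th].
rewrite !size_rcons => -[ss] [st] /nzd_seq_rcons[Gt Gtd].
rewrite -!cats1 !catA => cGt cGs.
have Gth : homog_gens (G ++ t) by apply/homog_gens_cat/pos_homogs_gens.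
have Gsh : homog_gens (G ++ s) by apply/homog_gens_cat/pos_homogs_gens.
have [y [yh cGty cGsy]] := common_parameter Gth Gsh tdh sdh cGt cGs.
have [Gy Gyt] : nzd_seq G (y :: t).
  apply: nzd_seq_rcons_cons => //; apply/nzd_seq_rcons; split=> //.
  exact: nzd_exchange tdh Gtd cGty.
have Gyh : homog_gens (G ++ [:: y]) by apply/homog_gens_cat/homog_gens1.
have Gys : nzd_seq (G ++ [:: y]) s.
  by apply: (IHd _ _ t) => //; apply: cofinite_catC.
rewrite cats1; apply/nzd_seq_rcons.
have /nzd_seq_rcons[Gs Gsy] : nzd_seq G (rcons s y) by apply: nzd_seq_cons_rcons.
by split=> //; apply: nzd_exchange yh Gsy cGs.
Qed.

End CommonParameter.

(** * Finite-dimensional linear algebra *)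

Section VectorSpaces.
Variable K : fieldType.

Lemma lfun_of (U V : vectType K) (f : U -> V) : linear f ->
  exists phi : 'Hom(U, V), forall u, phi u = f u.
Proof.
move=> f_lin; pose fL : {linear U -> V} := HB.pack f (GRing.isLinear.Build _ _ _ _ f f_lin).
by exists (linfun fL) => u; rewrite lfunE.
Qed.

(** Membership in an ideal is only a proposition; a subspace of maximal dimension
    inside [W] is a decidable substitute. *)
Lemma subspace_of (V : vectType K) (W : V -> Prop) :
    W 0 -> (forall a u v, W u -> W v -> W (a *: u + v)) ->
  exists U : {vspace V}, forall v, v \in U <-> W v.
Proof.
move=> W0 WD; pose P k := `[< exists2 U : {vspace V}, \dim U = k & forall v, v \in U -> W v >].
have exP : exists k, P k.
  exists 0%N; apply/asboolP; exists 0%VS; first exact: dimv0.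
  by move=> v; rewrite memv0 => /eqP->.
have leP k : P k -> (k <= dim V)%N.
  by case/asboolP => U <- _; rewrite -dimvf; apply/dimvS/subvf.
case: (ex_maxnP exP leP) => k /asboolP[U dimU UW] kmax.
exists U => v; split=> [/UW//|Wv]; apply: contrapT => /negP Uv.
suff /kmax : P k.+1 by rewrite ltnn.
have capUv : (U :&: <[v]> = 0)%VS.
  apply/eqP; rewrite -subv0; apply/subvP => u /memv_capP[Uu /vlineP[a def_u]].
  rewrite memv0 def_u; apply: contraNT Uv => av0.
  have a0 : a != 0 by apply: contraNneq av0 => ->; rewrite scale0r.
  by rewrite -(scalerK a0 v) -def_u memvZ.
apply/asboolP; exists (U + <[v]>)%VS.
  rewrite dimv_disjoint_sum // dim_vline dimU.
  suff ->: v != 0 by rewrite addn1.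
  by apply: contraNneq Uv => ->; rewrite mem0v.
move=> u /memv_addP[x Ux [_ /vlineP[a ->] ->]].
by rewrite addrC; apply: WD => //; apply: UW.
Qed.

Lemma dim_preim (U V : vectType K) (phi : 'Hom(U, V)) (X : {vspace V}) :
  (\dim (X + limg phi) + \dim (phi @^-1: X) = \dim X + dim U)%N.
Proof.
have imW : (phi @: (phi @^-1: X))%VS = (X :&: limg phi)%VS.
  by rewrite -lpreim_cap_limg lpreimK ?capvSr.
have kerW : (phi @^-1: X :&: lker phi)%VS = lker phi.
  by apply/capv_idPr; rewrite -lpreim0 lpreimS ?sub0v.
have := limg_ker_dim phi (phi @^-1: X); rewrite kerW imW => <-.
have := limg_ker_dim phi fullv; rewrite capfv dimvf => <-.
by have := dimv_sum_cap X (limg phi); lia.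
Qed.

End VectorSpaces.

(** * The cumulative Hilbert function *)

Section Hilbert.
Variables (n : nat) (K : fieldType).
Implicit Types (G s : seq {mpoly K[n]}) (f g p : {mpoly K[n]}).

(** Polynomials of degree at most [M], as coefficient vectors.  Bounding the
    degree, rather than fixing it, keeps nonhomogeneous polynomials in play; these
    are needed because the primes in a chain need not be homogeneous. *)
Definition coef_space M := {ffun 'X_{1..n < M.+1} -> K^o}.

Lemma dim_coef_space M : dim (coef_space M) = #|{: 'X_{1..n < M.+1}}|.
Proof. by rewrite /dim /= muln1. Qed.

Definition coefs M p : coef_space M := [ffun u => p@_(bmnm u)].
Definition poly_of M (v : coef_space M) : {mpoly K[n]} := \sum_u v u *: 'X_[bmnm u].

Lemma coefs_linear M : linear (coefs M).
Proof. by move=> a p q; apply/ffunP => u; rewrite !ffunE mcoeffD mcoeffZ. Qed.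
HB.instance Definition _ M :=
  GRing.isLinear.Build K {mpoly K[n]} (coef_space M) _ (coefs M) (coefs_linear M).

Lemma poly_of_linear M : linear (@poly_of M).
Proof.
move=> a v w; rewrite scaler_sumr -big_split /=; apply: eq_bigr => u _.
by rewrite !ffunE scalerDl scalerA.
Qed.
HB.instance Definition _ M :=
  GRing.isLinear.Build K (coef_space M) {mpoly K[n]} _ (@poly_of M) (@poly_of_linear M).

Lemma poly_ofK M : cancel (@poly_of M) (coefs M).
Proof.
move=> v; apply/ffunP => u; rewrite ffunE linear_sum /= (bigD1 u) //= big1.
  by rewrite addr0 mcoeffZ mcoeffX eqxx mulr1.
move=> w; rewrite mcoeffZ mcoeffX bmeqP eq_sym eq_sym => /negbTE->.
by rewrite mulr0.
Qed.

Definition mtrunc M p := poly_of (coefs M p).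

Lemma mcoeff_mtrunc M p u : (mtrunc M p)@_u = if (mdeg u <= M)%N then p@_u else 0.
Proof.
rewrite /mtrunc /poly_of linear_sum /=; case: leqP => [ltuM|ltMu].
  rewrite (bigD1 (BMultinom (ltuM : (mdeg u < M.+1)%N))) //= big1 ?addr0.
    by rewrite mcoeffZ mcoeffX eqxx mulr1 ffunE.
  by move=> w; rewrite bmeqP mcoeffZ mcoeffX => /negbTE->; rewrite mulr0.
rewrite big1 // => w _; rewrite mcoeffZ mcoeffX; case: eqP => [wu|_]; last by rewrite mulr0.
by have := bmdeg w; rewrite wu ltnS leqNgt ltMu.
Qed.

Lemma mtrunc_id M p : (msize p <= M.+1)%N -> mtrunc M p = p.
Proof.
move=> lepM; apply/mpolyP => u; rewrite mcoeff_mtrunc; case: leqP => // ltMu.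
by rewrite memN_msupp_eq0 // msize_mdeg_ge // (leq_trans lepM).
Qed.

Lemma mtruncE M p : mtrunc M p = \sum_(d < M.+1) pihomog mdeg d p.
Proof.
apply/mpolyP => u; rewrite mcoeff_mtrunc linear_sum /=.
under eq_bigr => d _ do rewrite mcoeff_pihomog.
case: leqP => [leuM|ltMu]; last first.
  rewrite big1 // => d _; case: eqP => // ud.
  by have := ltn_ord d; rewrite -ud ltnS leqNgt ltMu.
rewrite (bigD1 (Ordinal (leuM : (mdeg u < M.+1)%N))) //= eqxx big1 ?addr0 // => d nd.
by case: eqP => // ud; case/eqP: nd; apply/val_inj; rewrite /= ud.
Qed.

Lemma in_ideal_mtrunc G M p : homog_gens G -> in_ideal G p -> in_ideal G (mtrunc M p).
Proof.
by move=> Gh Gp; rewrite mtruncE; apply: in_ideal_sum => d _; apply: in_ideal_pihomog.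
Qed.

Lemma mtruncM M e p f : f \is e.-homog -> mtrunc (M + e) (p * f) = mtrunc M p * f.
Proof.
move=> fe; rewrite !mtruncE mulr_suml -addSn addnC big_split_ord /= big1 ?add0r.
  by apply: eq_bigr => d _; rewrite addnC pihomogM.
by move=> d _; apply: pihomogM_lt fe _.
Qed.

Lemma hspace_exists G M :
  exists U : {vspace coef_space M}, forall v, v \in U <-> in_ideal G (poly_of v).
Proof.
apply: subspace_of => [|a u v Gu Gv]; first by rewrite linear0; apply: in_ideal0.
by rewrite linearP /= -mul_mpolyC; apply: (in_ideal_is_ideal G).2.
Qed.

Definition hspace G M : {vspace coef_space M} := projT1 (cid (hspace_exists G M)).

Lemma mem_hspace G M v : v \in hspace G M <-> in_ideal G (poly_of v).
Proof. exact: (projT2 (cid (hspace_exists G M))). Qed.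

Lemma mem_hspace_coefs G M p : homog_gens G -> in_ideal G p -> coefs M p \in hspace G M.
Proof. by move=> Gh Gp; apply/mem_hspace/in_ideal_mtrunc. Qed.

(** The space of the larger ideal in degree [M + e] is the sum of that of [G] and
    of the multiples of [f], so rank-nullity for multiplication by [f] computes
    its dimension in terms of the colon space [W]. *)
Lemma hspace_cat1 G f e M : homog_gens G -> f \is e.-homog ->
  exists W : {vspace coef_space M}, (forall v, v \in W <-> in_ideal G (poly_of v * f)) /\
   (\dim (hspace (G ++ [:: f]) (M + e)) + \dim W
    = \dim (hspace G (M + e)) + dim (coef_space M))%N.
Proof.
move=> Gh fe; have [|phi phiE] := @lfun_of _ (coef_space M) (coef_space (M + e))
    (fun v => coefs (M + e) (poly_of v * f)).
  by move=> a u v; rewrite linearP /= mulrDl -scalerAl linearP.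
have polyphi v : poly_of (phi v) = poly_of v * f.
  by rewrite phiE -/(mtrunc _ _) (mtruncM _ _ fe) /mtrunc poly_ofK.
exists (phi @^-1: hspace G (M + e))%VS; split.
  by move=> v; rewrite -memv_preim -polyphi; apply: mem_hspace.
rewrite -(dim_preim phi); congr (\dim _ + _)%N; apply/vspaceP => w.
apply/idP/memv_addP => [/mem_hspace/in_ideal_cat1[g Gg [h def_w]]|].
  exists (coefs (M + e) g); first exact: mem_hspace_coefs.
  exists (phi (coefs M h)); first by apply: memv_img; apply: memvf.
  by rewrite -[w]poly_ofK def_w linearD /= phiE -/(mtrunc M h)
             -(mtruncM _ _ fe) /mtrunc poly_ofK.
move=> [x Gx [_ /memv_imgP[v _ ->] ->]]; apply/mem_hspace/in_ideal_cat1.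
by exists (poly_of x); [apply/mem_hspace | exists (poly_of v); rewrite linearD /= polyphi].
Qed.

End Hilbert.

(** * Growth of the Hilbert function and lengths of chains of primes *)

Section HilbertGrowth.
Variables (n : nat) (K : fieldType).
Implicit Types (G s : seq {mpoly K[n]}) (f g p : {mpoly K[n]}).

(** [f] is a nonzerodivisor when its colon space in each degree is the space of
    [G] itself.  By [hspace_cat1] this is an equality of dimensions. *)
Lemma nzd_hspaceP G f e : homog_gens G -> f \is e.-homog ->
  nzd G f <-> forall M, (\dim (hspace (G ++ [:: f]) (M + e)) + \dim (hspace G M)
    = \dim (hspace G (M + e)) + #|{: 'X_{1..n < M.+1}}|)%N.
Proof.
move=> Gh fe; split=> [Gf M | dimG g].
  have [W [WP dimW]] := hspace_cat1 M Gh fe; rewrite -(dim_coef_space _ K) -dimW.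
  congr (_ + \dim _)%N; apply/vspaceP => v; apply/idP/idP => [/mem_hspace Gv|/WP].
    by apply/WP/in_idealMr.
  by rewrite mulrC => /Gf/mem_hspace.
rewrite mulrC => Ggf; have lepM := leqnSn (msize g).
have [W [WP dimW]] := hspace_cat1 (msize g) Gh fe.
have GW : (hspace G (msize g) <= W)%VS.
  by apply/subvP => v /mem_hspace Gv; apply/WP/in_idealMr.
have /eqP eqGW : hspace G (msize g) == W.
  rewrite eqEdim GW; move: (dimG (msize g)); rewrite -(dim_coef_space _ K) -dimW.
  by move/addnI => ->; rewrite leqnn.
rewrite -(mtrunc_id lepM); apply/mem_hspace; rewrite eqGW; apply/WP.
by rewrite -/(mtrunc _ _) mtrunc_id.
Qed.

Definition hilb G M := (#|{: 'X_{1..n < M.+1}}| - \dim (hspace G M))%N.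

Lemma dim_hspace_le G M : (\dim (hspace G M) <= #|{: 'X_{1..n < M.+1}}|)%N.
Proof. by rewrite -(dim_coef_space _ K) -dimvf; apply/dimvS/subvf. Qed.

Lemma hilb_cat1 G f e M : homog_gens G -> f \is e.-homog ->
  (hilb G (M + e) <= hilb (G ++ [:: f]) (M + e) + hilb G M)%N.
Proof.
move=> Gh fe; have [W [WP dimW]] := hspace_cat1 M Gh fe.
have /dimvS : (hspace G M <= W)%VS.
  by apply/subvP => v /mem_hspace Gv; apply/WP/in_idealMr.
move: dimW (dim_hspace_le G M) (dim_hspace_le G (M + e)).
move: (dim_hspace_le (G ++ [:: f]) (M + e)); rewrite dim_coef_space /hilb; lia.
Qed.

Definition free_mod (J : {mpoly K[n]} -> Prop) (I : finType) (w : I -> {mpoly K[n]}) :=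
  forall c : I -> K, J (\sum_i c i *: w i) -> forall i, c i = 0.

Lemma hilb_free G M (I : finType) w : @free_mod (in_ideal G) I w ->
  (forall i, msize (w i) <= M.+1)%N -> (#|I| <= hilb G M)%N.
Proof.
move=> wfree wM.
have [|phi phiE] := @lfun_of _ {ffun I -> K^o} (coef_space n K M)
    (fun c => coefs M (\sum_i c i *: w i)).
  move=> a c d; have -> : \sum_i (a *: c + d) i *: w i
      = a *: (\sum_i c i *: w i) + \sum_i d i *: w i; last by rewrite linearP.
  rewrite scaler_sumr -big_split /=.
  by apply: eq_bigr => i _; rewrite !ffunE scalerDl scalerA.
have phi_free c : in_ideal G (poly_of (phi c)) -> c = 0.
  rewrite phiE -/(mtrunc _ _) mtrunc_id; last first.
    apply: leq_trans (mmeasure_sum _ _ _ _) _; apply/bigmax_leqP => i _.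
    exact: leq_trans (mmeasureZ_le _ _ _) (wM i).
  by move=> /wfree c0; apply/ffunP => i; rewrite c0 ffunE.
have ker0 : lker phi = 0%VS.
  apply/eqP; rewrite -subv0; apply/subvP => c; rewrite memv_ker memv0 => /eqP phic.
  by apply/eqP/phi_free; rewrite phic linear0; apply: in_ideal0.
have cap0 : (hspace G M :&: limg phi = 0)%VS.
  apply/eqP; rewrite -subv0; apply/subvP => v /memv_capP[Gv /memv_imgP[c _ def_v]].
  by rewrite memv0 def_v (phi_free c) ?linear0 // -def_v; apply/mem_hspace.
have dimI : \dim (limg phi) = #|I|.
  by rewrite limg_dim_eq ?ker0 ?capv0 // dimvf /dim /= muln1.
have := dimvS (subvf (hspace G M + limg phi)).
rewrite dimv_disjoint_sum // dimI dimvf dim_coef_space /hilb; lia.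
Qed.

Lemma cofinite_hilb G : homog_gens G -> cofinite G -> exists C, forall M, (hilb G M <= C)%N.
Proof.
move=> Gh [m Gm]; exists #|{: 'X_{1..n < m.+1}}| => M.
have [|phi phiE] := @lfun_of _ (coef_space n K m) (coef_space n K M)
    (fun v => coefs M (poly_of v)).
  by move=> a u v; rewrite !linearP.
have /dimvS : (fullv <= hspace G M + limg phi)%VS.
  apply/subvP => v _; rewrite -[v]poly_ofK -[poly_of v](subrK (mtrunc m (poly_of v))).
  rewrite linearD /=; apply: memv_add; last first.
    by rewrite /mtrunc -phiE; apply/memv_img/memvf.
  apply: mem_hspace_coefs => //; apply: in_ideal_msupp => u.
  rewrite mcoeff_msupp mcoeffB mcoeff_mtrunc; case: leqP => [_|/ltnW/Gm//].
  by rewrite subrr eqxx.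

have := leq_trans (dimv_add_leqif (hspace G M) (limg phi)).1 (leqnn _).
have : (\dim (limg phi) <= #|{: 'X_{1..n < m.+1}}|)%N.
  by rewrite -(dim_coef_space _ K) -dimvf -(limg_ker_dim phi) leq_addl.
rewrite dimvf dim_coef_space /hilb; lia.
Qed.

Lemma leq_expl a b k : (a <= b)%N -> (a ^ k <= b ^ k)%N.
Proof. by move=> leab; elim: k => // k IHk; rewrite !expnS leq_mul. Qed.

(** Dividing by a homogeneous element of degree [e] lowers the order of growth of
    the Hilbert function by at most one: sum [hilb_cat1] over steps of length [e]. *)
Lemma hilb_growth_cat1 G f k C : homog_gens G -> pos_homog f ->
    (forall M, hilb (G ++ [:: f]) M <= C * M.+1 ^ k)%N ->
  exists C', forall M, (hilb G M <= C' * M.+1 ^ k.+1)%N.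
Proof.
move=> Gh [e e0 fe] GC; pose C' := (C + #|{: 'X_{1..n < e.+1}}|)%N; exists C'.
have hilb_le M : (hilb G M <= #|{: 'X_{1..n < M.+1}}|)%N by apply: leq_subr.
have card_le M : (M <= e)%N -> (#|{: 'X_{1..n < M.+1}}| <= C')%N.
  move=> leMe; rewrite (leq_trans _ (leq_addl _ _)) //.
  have winj : injective (fun u : 'X_{1..n < M.+1} =>
      BMultinom (leq_trans (bmdeg u) (leMe : (M.+1 <= e.+1)%N))).
    by move=> u v [uv]; apply/val_inj.
  exact: leq_card winj.
(* Degrees below e have no predecessor to recurse to; C' absorbs them. *)
elim/ltn_ind => M IHM; have [ltMe|leeM] := ltnP M e.
  rewrite (leq_trans (hilb_le M)) // (leq_trans (card_le _ (ltnW ltMe))) //.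
  by rewrite leq_pmulr // expn_gt0.
rewrite -{1}(subnK leeM); apply: leq_trans (hilb_cat1 _ Gh fe) _.
rewrite subnK // expnS mulnCA mulSn.
apply: leq_add.
  by apply: leq_trans (GC M) _; rewrite leq_mul2r leq_addr orbT.
apply: leq_trans (IHM _ _) _; first by rewrite ltn_subrL e0 (leq_trans e0).
rewrite expnS mulnCA; apply: leq_mul; first by lia.
by apply: leq_mul => //; apply: leq_expl; lia.
Qed.

Lemma hilb_growth G s : homog_gens G -> pos_homogs s -> cofinite (G ++ s) ->
  exists C, forall M, (hilb G M <= C * M.+1 ^ size s)%N.
Proof.
elim: s G => [|x s IHs] G Gh; rewrite ?cats0.
  move=> _ /(cofinite_hilb Gh)[C GC]; exists C => M.
  by rewrite expn0 muln1.
move=> /pos_homogs_cons[xh sh]; rewrite -cat1s catA => Gs.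
have Gxh : homog_gens (G ++ [:: x]) by apply/homog_gens_cat/homog_gens1.
have [C GC] := IHs _ Gxh sh Gs; exact: hilb_growth_cat1 xh GC.
Qed.

Lemma msizeM_leq f g a b : (msize f <= a.+1)%N -> (msize g <= b.+1)%N ->
  (msize (f * g) <= (a + b).+1)%N.
Proof.
have [->|f0] := eqVneq f 0; first by rewrite mul0r msize0.
have [->|g0] := eqVneq g 0; first by rewrite mulr0 msize0.
move=> fa gb; rewrite msizeM // -subn1 leq_subLR add1n.
by apply: leq_trans (leq_add fa gb) _; rewrite addSn addnS.
Qed.

Lemma msizeX_leq f a k : (msize f <= a.+1)%N -> (msize (f ^+ k) <= (a * k).+1)%N.
Proof.
move=> fa; elim: k => [|k IHk]; first by rewrite expr0 msize1.
by rewrite exprS mulnS; apply: msizeM_leq.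
Qed.

(** In a vanishing combination the coefficient of [f ^+ 0] lies in [Q], since [f]
    does, and so its coefficients vanish; the rest is divisible by [f], which can
    be cancelled modulo [P]. *)
Lemma free_mod_powers (P Q : {pred {mpoly K[n]}}) f m (I : finType) w :
    prime_ideal P -> prime_ideal Q -> {subset P <= Q} -> f \in Q -> f \notin P ->
    @free_mod (fun g => g \in Q) I w ->
  free_mod (fun g => g \in P) (fun ji : 'I_m * I => f ^+ ji.1 * w ji.2).
Proof.
move=> [[P0 _ PD] PM] [[Q0 _ QD] _] PQ Qf Pf wfree.
have free_nat k (c : nat -> I -> K) :
    \sum_(j < k) f ^+ j * (\sum_i c j i *: w i) \in P ->
  forall j, (j < k)%N -> forall i, c j i = 0.
  elim: k c => // k IHk c; rewrite big_ord_recl expr0 mul1r.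
  pose g := \sum_(j < k) f ^+ j * (\sum_i c j.+1 i *: w i).
  rewrite [X in _ + X](_ : _ = f * g) => [Pc|]; last first.
    by rewrite mulr_sumr; apply: eq_bigr => j _; rewrite exprS mulrA.
  have c0 : forall i, c 0%N i = 0.
    apply: wfree; have := QD (- g) f _ Qf (PQ _ Pc).
    by rewrite mulNr addrC [f * g]mulrC addrK.
  rewrite big1 ?add0r in Pc; last by move=> i _; rewrite c0 scale0r.
  have Pg : g \in P by move: (PM _ _ Pc); rewrite (negbTE Pf).
  by case=> // j ltjk; apply: (IHk (fun j => c j.+1)).
move=> c Pc [j i]; pose c' k i' := if insub k is Some k' then c (k', i') else 0.
have := free_nat m c' _ j (ltn_ord j) i; rewrite /c' valK; apply.
rewrite (eq_bigr (fun k : 'I_m => \sum_i' c (k, i') *: (f ^+ k * w i'))) => [|k _].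
  rewrite pair_bigA /=; rewrite (eq_bigr (fun ji => c ji *: (f ^+ ji.1 * w ji.2))) //.
  by case.
by rewrite valK mulr_sumr; apply: eq_bigr => i' _; rewrite scalerAr.
Qed.

(** A chain of [e] strict inclusions provides [e] elements, one in each step, whose
    monomials are linearly independent modulo the lowest prime.  The [m ^ e]
    monomials with exponents below [m] have degree at most linear in [m]. *)
Lemma chain_free G e Ps : prime_chain G e Ps -> exists D, forall m,
  exists (I : finType) (w : I -> {mpoly K[n]}),
  [/\ #|I| = (m ^ e)%N, forall i, (msize (w i) <= (D * m).+1)%N
    & free_mod (fun f => f \in Ps 0%N) w].
Proof.
elim: e G Ps => [|e IHe] G Ps [Ppr Plt].
  exists 0%N => m; exists unit, (fun=> 1); split=> [|_|c].
  - by rewrite card_unit.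
  - by rewrite msize1.
  rewrite (big_pred1 tt) => [|[]//] Pc []; apply: contrapT => /eqP c0.
  have [[[_ P1 PD] _] _] := Ppr 0%N isT; case/negP: P1.
  have := PD (c tt)^-1%:MP _ 0 Pc.
  rewrite addr0 -scalerAr mulr1 -mul_mpolyC -mpolyCM mulfV // mpolyC1.
  by apply; case: (Ppr 0%N isT) => -[[]].
have [[[[P00 P01 P0D] P0M] GP0] [P01sub /existsNP[f /not_implyP[P1f /negP P0f]]]] :=
  conj (Ppr 0%N isT) (Plt 0%N isT).
have [|D IH] := IHe G (fun i => Ps i.+1).
  by split=> i lti; [apply: Ppr | apply: Plt].
exists (D + msize f)%N => m; have [I [w [cardI wD wfree]]] := IH m.
have [prP1 _] := Ppr 1%N isT; have [prP0 _] := Ppr 0%N isT.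
exists ('I_m * I)%type, (fun ji : 'I_m * I => f ^+ ji.1 * w ji.2); split.
- by rewrite card_prod card_ord cardI -expnS.
- move=> [j i] /=; rewrite mulnDl addnC; apply: msizeM_leq => //.
  apply: leq_trans (msizeX_leq j (leqnSn (msize f))) _.
  by have := leq_mul (leqnn (msize f)) (ltnW (ltn_ord j)).
exact: free_mod_powers prP1 _ _ _ wfree.
Qed.

Lemma chain_hilb G e : has_chain G e -> exists D, forall m, (m ^ e <= hilb G (D * m))%N.
Proof.
move=> [Ps PsG]; have [D wD] := chain_free PsG; exists D => m.
have [I [w [<- wdeg wfree]]] := wD m; apply: hilb_free wdeg => c Gc.
have [prP GP] := PsG.1 0%N isT.
exact/wfree/(in_ideal_prime prP GP).
Qed.

End HilbertGrowth.

Lemma growth_exponents (H : nat -> nat) C D e k :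
  (forall m, m ^ e <= H (D * m))%N -> (forall M, H M <= C * M.+1 ^ k)%N -> (e <= k)%N.
Proof.
move=> lowH upH; rewrite leqNgt; apply/negP => ltke.
(* With this m, already m ^ k.+1 exceeds C * (D.+1 * m) ^ k. *)
pose m := (C * D.+1 ^ k).+1.
have : (m ^ e <= C * (D.+1 * m) ^ k)%N.
  apply: leq_trans (lowH m) _; apply: leq_trans (upH _) _; rewrite leq_mul2l.
  by apply/orP; right; apply: leq_expl; rewrite mulSn; have : (0 < m)%N by []; lia.
rewrite -(subnK ltke) addnS -addSn expnD expnMn mulnA leq_pmul2r ?expn_gt0 //.
rewrite leqNgt => /negP[]; rewrite expnS; apply: (@leq_pmulr m).
by rewrite expn_gt0.
Qed.

(** * Spans of edge vectors of a graph *)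

Section GraphSpan.
Variables (I : finType) (L : seq (option I * option I)).

Definition adjacent : rel (option I) := fun x y => ((x, y) \in L) || ((y, x) \in L).

Lemma adjacent_sym : symmetric adjacent. Proof. by move=> x y; apply: orbC. Qed.

Lemma connect_adjacent_sym : connect_sym adjacent.
Proof. by apply: sym_connect_sym; apply: adjacent_sym. Qed.

Variable K : fieldType.

(** [None] is an additional vertex whose vector is zero: edges to it encode
    monomials, the other edges encode binomials. *)
Definition vertex (x : option I) : {ffun I -> K^o} :=
  [ffun i => if x is Some j then (j == i)%:R else 0].

Definition edge_vector (x : option I * option I) := vertex x.1 - vertex x.2.

Definition edge_span : {vspace {ffun I -> K^o}} := <<[seq edge_vector x | x <- L]>>%VS.

(** Telescoping along a path gives one direction.  For the other, let [chi]
    be the indicator function of the connected component of [x].  The linear form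
    that takes the value [chi z - chi None] on the vector of each vertex [z]
    vanishes on all edges and separates [x] from the vertices outside its
    component. *)
Lemma edge_span_connect x y : edge_vector (x, y) \in edge_span <-> connect adjacent x y.
Proof.
split=> [xyL|/connectP[p]]; last first.
  elim: p x => [|z p IHp] x /=; first by move=> _ ->; rewrite /edge_vector subrr mem0v.
  move=> /andP[xz zp] /(IHp _ zp) zyL.
  have -> : edge_vector (x, y) = edge_vector (x, z) + edge_vector (z, y).
    by rewrite /edge_vector /= addrA subrK.
  apply: memvD zyL; case/orP: xz => xzL; first exact/memv_span/map_f.
  have -> : edge_vector (x, z) = - edge_vector (z, x) by rewrite /edge_vector opprB.
  by rewrite memvN; apply/memv_span/map_f.
pose chi z : K := (connect adjacent x z)%:R.
pose ell (v : {ffun I -> K^o}) : K^o := \sum_i (v i : K) * (chi (Some i) - chi None).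
have [|phi phiE] := @lfun_of _ {ffun I -> K^o} K^o ell.
  move=> a u v; rewrite /ell scaler_sumr -big_split; apply: eq_bigr => i _.
  by rewrite !ffunE mulrDl scalerAl.
have phi_vertex z : phi (vertex z) = chi z - chi None.
  rewrite phiE /ell; case: z => [j|]; last first.
    by rewrite subrr big1 // => i _; rewrite ffunE mul0r.
  rewrite (bigD1 j) //= big1 ?addr0 ?ffunE ?eqxx ?mul1r // => i nij.
  by rewrite ffunE eq_sym (negbTE nij) mul0r.
have phi_edge z1 z2 : phi (edge_vector (z1, z2)) = chi z1 - chi z2.
  by rewrite /edge_vector linearB /= !phi_vertex opprB addrA subrK.
have /subvP/(_ _ xyL) : (edge_span <= lker phi)%VS.
  apply/span_subvP => _ /mapP[[z1 z2] z12 ->]; rewrite memv_ker phi_edge subr_eq0 /chi.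
  have z12a : connect adjacent z1 z2 by apply: connect1; rewrite /adjacent z12.
  by rewrite (same_connect_r connect_adjacent_sym z12a).
rewrite memv_ker phi_edge subr_eq0 /chi connect0.
by case: (connect _ x y) => //; rewrite oner_eq0.
Qed.

End GraphSpan.

(** Adding an edge raises the dimension exactly when its ends are not yet
    connected, a condition in which the field does not occur. *)
Lemma dim_edge_span (I : finType) (L : seq (option I * option I)) (K K' : fieldType) :
  \dim (edge_span L K) = \dim (edge_span L K').
Proof.
elim: L => [|x L IHL]; first by rewrite /edge_span /= !span_nil !dimv0.
have dimS (F : fieldType) : \dim (edge_span (x :: L) F)
    = (\dim (edge_span L F) + ~~ connect (adjacent L) x.1 x.2)%N.
  rewrite /edge_span /= span_cons addvC -/(edge_span L F).
  have xP := edge_span_connect L F x.1 x.2.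
  rewrite -surjective_pairing in xP.
  have [conn|nconn] := boolP (connect _ _ _).
    by rewrite addn0 (addv_idPl _) // -memvE; apply/xP.
  have Lx : edge_vector F x \notin edge_span L F by apply: contra nconn => /xP.
  rewrite dimv_disjoint_sum ?dim_vline.
    by have -> : edge_vector F x != 0 by apply: contraNneq Lx => ->; apply: mem0v.
  apply/eqP; rewrite -subv0; apply/subvP => v /memv_capP[Lv /vlineP[a def_v]].
  rewrite memv0 def_v; apply: contraNT Lx => ax0.
  have a0 : a != 0 by apply: contraNneq ax0 => ->; rewrite scale0r.
  by rewrite -(scalerK a0 (edge_vector F x)) -def_v memvZ.
by rewrite !dimS IHL.
Qed.

(** * Hilbert functions of binomial ideals *)

Section BinomialIdeals.
Variable n : nat.
Implicit Types (K : fieldType) (E : seq ('X_{1..n} * option 'X_{1..n})).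

(** The exponents [(u, Some v)] stand for a binomial, [(u, None)] for a monomial. *)
Definition binom_poly (K : fieldType) (e : 'X_{1..n} * option 'X_{1..n}) : {mpoly K[n]} :=
  'X_[e.1] - oapp (@mpolyX n K) 0 e.2.

Definition binomials K E := [seq binom_poly K e | e <- E].

Definition homog_binomials E : Prop :=
  forall u v, (u, Some v) \in E -> mdeg v = mdeg u.

Lemma binom_poly_homog K E e : homog_binomials E -> e \in E ->
  binom_poly K e \is (mdeg e.1).-homog.
Proof.
case: e => u [v|] Eh Ee; rewrite /binom_poly /=.
  by rewrite rpredB ?dhomogX //= (Eh _ _ Ee).
by rewrite subr0 dhomogX.
Qed.

Lemma binomials_homog K E : homog_binomials E -> homog_gens (binomials K E).
Proof. by move=> Eh _ /mapP[e Ee ->]; exists (mdeg e.1); apply: binom_poly_homog Ee. Qed.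

(** The graph on the monomials of degree at most [M] whose edges are the monomial
    multiples of the generators; [insub] sends a monomial of too large degree to
    [None]. *)
Definition mon_edges M E : seq (option 'X_{1..n < M.+1} * option 'X_{1..n < M.+1}) :=
  [seq (insub (w + e.1)%MM, obind (fun v => insub (w + v)%MM) e.2)
     | e <- E, w <- [seq bmnm w | w <- enum {: 'X_{1..n < M.+1}}]].

Lemma coefsX K M u : coefs M ('X_[u] : {mpoly K[n]}) = vertex K (insub u).
Proof.
apply/ffunP => w; rewrite !ffunE mcoeffX; case: insubP => [u' _ <-|]; first by rewrite bmeqP.
by case: eqP => // ->; rewrite bmdeg.
Qed.

Lemma coefs_binom_poly K M w e : coefs M ('X_[w] * binom_poly K e)
  = edge_vector K (insub (w + e.1)%MM, obind (fun v => insub (w + v)%MM) e.2).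
Proof.
rewrite /edge_vector /binom_poly mulrBr linearB /= -mpolyXD coefsX; congr (_ - _).
case: e.2 => [v|] /=; first by rewrite -mpolyXD coefsX.
by rewrite mulr0 linear0; apply/ffunP => i; rewrite !ffunE.
Qed.

(** Homogeneity matters here: a monomial multiple of a binomial has both terms of
    degree at most [M], or none. *)
Lemma hspace_binomials K E M : homog_binomials E ->
  hspace (binomials K E) M = edge_span (mon_edges M E) K.
Proof.
move=> Eh; apply/vspaceP => v; apply/idP/idP => [/mem_hspace Gv|]; last first.
  apply/subvP/span_subvP => _ /mapP[_ /allpairsP[[e w] [/= Ee _ ->]] ->].
  rewrite -coefs_binom_poly; apply: mem_hspace_coefs; first exact: binomials_homog.
  by apply/in_idealMl/in_ideal_mem/map_f.
(* Quantifying over the multiplier w makes the property stable under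
   multiplication by arbitrary polynomials. *)
suff GJ : forall f, in_ideal (binomials K E) f ->
    forall w, coefs M ('X_[w] * f) \in edge_span (mon_edges M E) K.
  by have := GJ _ Gv 0%MM; rewrite mpolyX0 mul1r poly_ofK.
apply: in_ideal_min => [|_ /mapP[e Ee ->] w].
  split=> [w|a f g Jf Jg w]; first by rewrite mulr0 linear0 mem0v.
  rewrite mulrDr linearD /=; apply: memvD => //.
  rewrite [a]mpolyE mulr_suml mulr_sumr linear_sum; apply: memv_suml => u _ /=.
  by rewrite -scalerAl -scalerAr linearZ /= mulrA -mpolyXD memvZ.
rewrite coefs_binom_poly; have [lewM|ltMw] := leqP (mdeg w) M.
  apply/memv_span/map_f/allpairsP; exists (e, w); split=> //.
  by apply/mapP; exists (BMultinom (lewM : (mdeg w < M.+1)%N)); rewrite ?mem_enum.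
rewrite [insub (w + e.1)%MM]insubF; last by rewrite mdegD ltnS; lia.
suff ->: obind (fun v => insub (w + v)%MM) e.2 = None :> option 'X_{1..n < M.+1}.
  by rewrite /edge_vector subrr mem0v.
by case: e.2 => //= u; rewrite insubF // mdegD ltnS; lia.
Qed.

Lemma dim_hspace_binomials K K' E M : homog_binomials E ->
  \dim (hspace (binomials K E) M) = \dim (hspace (binomials K' E) M).
Proof. by move=> Eh; rewrite !hspace_binomials //; apply: dim_edge_span. Qed.

Lemma in_binomials_mon K E u : homog_binomials E ->
  in_ideal (binomials K E) 'X_[u] <->
  connect (adjacent (mon_edges (mdeg u) E)) (insub u) None.
Proof.
move=> Eh; rewrite -(edge_span_connect _ K) -hspace_binomials //.
have -> : edge_vector K (insub u, None) = coefs (mdeg u) ('X_[u] : {mpoly K[n]}).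
  by rewrite coefsX /edge_vector /=; apply/ffunP => i; rewrite !ffunE subr0.
by rewrite -{1}(@mtrunc_id _ _ (mdeg u) 'X_[u]) ?msizeX //; apply: iff_sym; apply: mem_hspace.
Qed.

Lemma cofinite_binomials K K' E : homog_binomials E ->
  cofinite (binomials K E) -> cofinite (binomials K' E).
Proof.
move=> Eh [m Km]; exists m => u /Km /in_binomials_mon-/(_ Eh) uE.
by apply/in_binomials_mon.
Qed.

Lemma proper_binomials K K' E : homog_binomials E ->
  in_ideal (binomials K E) 1 -> in_ideal (binomials K' E) 1.
Proof.
move=> Eh; rewrite -!mpolyX0 => /in_binomials_mon-/(_ Eh) uE.
by apply/in_binomials_mon.
Qed.

End BinomialIdeals.

(** * Independence of the field *)

Lemma over_field_binomials n (F : seq {mpoly int[n]}) :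
    {in F, forall f, monomial_or_homog_binomial f} ->
  exists2 E, homog_binomials E & forall K : fieldType, over_field K F = binomials K E.
Proof.
elim: F => [|f F IHF] hF; first by exists [::].
have [|E Eh EF] := IHF; first by move=> g Fg; apply: hF; rewrite inE Fg orbT.
have [e [eh ef]] : exists e : 'X_{1..n} * option 'X_{1..n},
    homog_binomials [:: e] /\
    forall K : fieldType, map_mpoly (intr : int -> K) f = binom_poly K e.
  have [[u ->]|[u [v [duv ->]]]] := hF f (mem_head _ _).
    exists (u, None); split=> [? ?|K]; first by rewrite inE => /eqP[].
    by rewrite map_mpolyX /binom_poly /= subr0.
  exists (u, Some v); split=> [u' v'|K]; first by rewrite inE => /eqP[-> ->].
  by rewrite rmorphB /= !map_mpolyX.
exists (e :: E) => [u v|K]; last by rewrite /= ef EF.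
by rewrite inE => /orP[uve|/Eh//]; apply: eh; rewrite inE.
Qed.

Definition linear_binomials n (E : seq ('X_{1..n} * option 'X_{1..n})) : Prop :=
  homog_binomials E /\ {in E, forall e, mdeg e.1 = 1%N}.

Lemma special_binomials n (K : fieldType) (s : seq {mpoly K[n]}) :
    {in s, forall f, variable_or_difference f} ->
  exists2 E, linear_binomials E & s = binomials K E.
Proof.
elim: s => [|f s IHs] hs; first by exists [::].
have [|E [Eh E1] ->] := IHs; first by move=> g sg; apply: hs; rewrite inE sg orbT.
have [e [eh e1 ->]] : exists e : 'X_{1..n} * option 'X_{1..n},
    [/\ homog_binomials [:: e], mdeg e.1 = 1%N & f = binom_poly K e].
  have [[i ->]|[k [i [_ ->]]]] := hs f (mem_head _ _).
    exists (U_(i)%MM, None); split=> [? ?||]; rewrite ?mdeg1 //.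
      by rewrite inE => /eqP[].
    by rewrite /binom_poly /= subr0.
  exists (U_(k)%MM, Some U_(i)%MM); split=> [u v||]; rewrite ?mdeg1 //.
  by rewrite inE => /eqP[-> ->]; rewrite !mdeg1.
exists (e :: E) => //; split=> [u v|e']; rewrite inE => /orP[ee|Ee].
- by apply: eh; rewrite inE.
- exact: Eh.
- by rewrite (eqP ee).
exact: E1.
Qed.

Section FieldIndependence.
Variable n : nat.
Implicit Types (K L : fieldType) (E B : seq ('X_{1..n} * option 'X_{1..n})).

Lemma homog_binomials_cat E B :
  homog_binomials E -> homog_binomials B -> homog_binomials (E ++ B).
Proof. by move=> Eh Bh u v; rewrite mem_cat => /orP[/Eh|/Bh]. Qed.

Lemma hilb_binomials K L E M : homog_binomials E ->
  hilb (binomials K E) M = hilb (binomials L E) M.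
Proof. by move=> Eh; rewrite /hilb (dim_hspace_binomials K L). Qed.

Lemma nzd_seq_binomials K L E B : homog_binomials E -> homog_binomials B ->
  nzd_seq (binomials K E) (binomials K B) -> nzd_seq (binomials L E) (binomials L B).
Proof.
elim: B E => //= b B IHB E Eh bBh [Kb KB].
have bh : homog_binomials [:: b].
  by move=> u v; rewrite inE => uvb; apply: bBh; rewrite inE uvb.
have Bh : homog_binomials B by move=> u v uvB; apply: bBh; rewrite inE uvB orbT.
have Ebh := homog_binomials_cat Eh bh.
have Eb F : binomials F E ++ [:: binom_poly F b] = binomials F (E ++ [:: b]).
  by rewrite /binomials map_cat.
have bdeg F : binom_poly F b \is (mdeg b.1).-homog.
  by apply: (@binom_poly_homog _ F [:: b]); rewrite ?mem_head.
rewrite Eb in KB; split; last by rewrite Eb; apply: IHB Ebh Bh KB.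
move/(nzd_hspaceP (binomials_homog Eh) (bdeg K)): Kb => Kb.
apply/(nzd_hspaceP (binomials_homog Eh) (bdeg L)) => M.
rewrite Eb !(dim_hspace_binomials L K) // -Eb; apply: Kb.
Qed.

Lemma pos_homogs_binomials K B : linear_binomials B -> pos_homogs (binomials K B).
Proof.
move=> [Bh B1] _ /mapP[b Bb ->]; exists 1%N => //.
by rewrite -(B1 b Bb); apply: binom_poly_homog Bh Bb.
Qed.

(** Upper and lower growth of the Hilbert function bound the length of a chain of
    primes by the number of elements in a homogeneous sequence of finite colength. *)
Lemma chain_le_sop K (G s : seq {mpoly K[n]}) e : homog_gens G -> pos_homogs s ->
  cofinite (G ++ s) -> has_chain G e -> (e <= size s)%N.
Proof.
move=> Gh sh /(hilb_growth Gh sh)[C GC] /chain_hilb[D GD].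
exact: growth_exponents GD GC.
Qed.

Lemma homog_regular_seq_chain K (G s : seq {mpoly K[n]}) :
  homog_regular_seq G s -> has_chain G (size s).
Proof.
move=> [_ /regular_seqP[Gs /has_chain0]].
by move=> /(has_chain_nzd_seq Gs).
Qed.

Lemma nzd_sop_cohen_macaulay K (G s : seq {mpoly K[n]}) :
    homog_gens G -> pos_homogs s -> cofinite (G ++ s) -> ~ in_ideal (G ++ s) 1 ->
  nzd_seq G s -> cohen_macaulay G.
Proof.
move=> Gh sh cGs Gs1 Gs; right; exists (size s).
  split; first by apply: has_chain_nzd_seq Gs (has_chain0 Gs1).
  by move=> e P GP; apply: chain_le_sop Gh sh cGs _; exists P.
split; first by exists s => //; split=> //; apply/regular_seqP.
move=> r Gr; apply: chain_le_sop Gh sh cGs _; exact: homog_regular_seq_chain.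
Qed.

(** Otherwise a chain of length one above the ideal of [G ++ s] would extend
    downwards to one that is longer than the dimension. *)
Lemma max_regular_cofinite K (G s : seq {mpoly K[n]}) : homog_gens G -> pos_homogs s ->
  has_krull_dim G (size s) -> nzd_seq G s -> cofinite (G ++ s).
Proof.
move=> Gh sh [_ dimG] Gs; apply: contrapT => ncGs.
have Gsh : homog_gens (G ++ s) by apply/homog_gens_cat/pos_homogs_gens.
have [P GP] := has_chain_nzd_seq Gs (not_cofinite_chain Gsh ncGs).
by have := dimG _ _ GP; rewrite ltnn.
Qed.

(** The dimension over [L] is compared with the one over [K] through the common
    Hilbert function: a regular sequence of maximal length over [L] bounds its
    growth from above, the chain of primes over [K] from below.  So this sequence
    has at least as many terms as [B], by [chain_le_sop] exactly as many, and
    [sop_nzd_seq] applies. *)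
Lemma cohen_macaulay_binomials K L E B : homog_binomials E -> linear_binomials B ->
    has_chain (binomials K E) (size B) -> ~ in_ideal (binomials K (E ++ B)) 1 ->
    cofinite (binomials K (E ++ B)) ->
  cohen_macaulay (binomials L E) <-> nzd_seq (binomials L E) (binomials L B).
Proof.
move=> Eh Blin Kchain K1 Kcof; have [Bh _] := Blin.
have EBh := homog_binomials_cat Eh Bh.
have EhL := binomials_homog (K := L) Eh; have sh := pos_homogs_binomials (K := L) Blin.
have EB : binomials L (E ++ B) = binomials L E ++ binomials L B by apply: map_cat.
have Lcof : cofinite (binomials L E ++ binomials L B).
  by rewrite -EB; apply: cofinite_binomials Kcof.
have L1 : ~ in_ideal (binomials L E ++ binomials L B) 1.
  by rewrite -EB => /(proper_binomials K EBh).
split=> [[G1|[d dimG [[t [th /regular_seqP[Gt _]] td] _]]]|].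
- by case: L1; apply: in_ideal_catl.
- rewrite -td in dimG.
  have cGt := max_regular_cofinite EhL th dimG Gt.
  apply: (sop_nzd_seq EhL sh th (erefl _) _ Gt cGt Lcof).
  have [[P GP] _] := dimG; apply/eqP; rewrite eqn_leq (chain_le_sop EhL sh Lcof) /=.
    rewrite size_map; have [D KD] := chain_hilb Kchain.
    have [C LC] := hilb_growth EhL th cGt; apply: growth_exponents KD _ => M.
    by rewrite (hilb_binomials K L).
  by exists P.
exact: nzd_sop_cohen_macaulay.
Qed.

End FieldIndependence.

Theorem theorem1p5 (n : nat) (F : seq {mpoly int[n]})
    (hF : {in F, forall f, monomial_or_homog_binomial f})
    (K : fieldType)
    (hK : exists s : seq {mpoly K[n]}, special_sop (over_field K F) s) :
  forall K' : fieldType,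
    cohen_macaulay (over_field K' F) <-> cohen_macaulay (over_field K F).
Proof.
move=> K'; have [E Eh EF] := over_field_binomials hF; rewrite !EF.
case: hK => s [[sh [Kchain _] [K0 Kdim0]] /special_binomials[B Blin def_s]].
have [Bh _] := Blin; rewrite EF def_s size_map in Kchain K0 Kdim0.
have EB : binomials K (E ++ B) = binomials K E ++ binomials K B by apply: map_cat.
have Kcof : cofinite (binomials K (E ++ B)).
  apply: contrapT => /not_cofinite_chain[|P EP].
    exact/binomials_homog/homog_binomials_cat.
  by rewrite EB in EP; have := Kdim0 _ _ EP.
have K1 : ~ in_ideal (binomials K (E ++ B)) 1.
  by rewrite EB; apply: has_chain_proper K0.
rewrite !(cohen_macaulay_binomials _ Eh Blin Kchain K1 Kcof).
by split; apply: nzd_seq_binomials.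
Qed.
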